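(* Let $n\ge 2$, let $\Omega\subset\mathbb{R}^n$ be an open ball centered at the origin or $\Omega=\mathbb{R}^n$, and let $G$ be a projectively flat spherically symmetric spray on $\Omega$ with coefficients $G^i=|y|\,p(r,s)\,y^i$, where $r=|x|^2$ and $s=\langle x,y\rangle/|y|$. Then $G$ has isotropic curvature if and only if $$p(r,s)=\left[\int\frac{u(r-s^2)}{s^2}\,ds+v(r)\right]s,$$ where $u$ and $v$ are (arbitrary) smooth functions of one variable, with the integral chosen so that $p$ is well-defined. In particular, $G$ has zero curvature if and only if either (i) $p\equiv 0$ (the spray being defined on $\mathbb{R}^n\times\mathbb{R}^n$); or (ii) $p(r,s)=\dfrac{s\pm\sqrt{s^2-r+c}}{c-r}$ with $c>0$ a constant, where the spray is defined on $B^n_{\sqrt c}(0)\times\mathbb{R}^n$. In case (ii) the expression is of the integral form above with $u(r-s^2)=\mp\frac{1}{\sqrt{s^2-r+c}}$ and an appropriate $v(r)$.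
   Context: $|\cdot|$ and $\langle\cdot,\cdot\rangle$ are the Euclidean norm and inner product; $B^n_{\rho}(0)$ is the open ball of radius $\rho$ centered at $0$. A spray on $\Omega$ is a smooth vector field $G=y^i\frac{\partial}{\partial x^i}-2G^i(x,y)\frac{\partial}{\partial y^i}$ on $\Omega\times(\mathbb{R}^n\setminus\{0\})$ with $G^i(x,\lambda y)=\lambda^2G^i(x,y)$ for $\lambda>0$. It is spherically symmetric if $G^i(Ux,Uy)=\sum_jU^i_jG^j(x,y)$ for all $U\in O(n)$ (i.e. $G$ is invariant under $(x,y)\mapsto(Ux,Uy)$). It is projectively flat if $G^i=P(x,y)y^i$ with $P$ positively homogeneous of degree one in $y$; a projectively flat spherically symmetric spray has $P=|y|\,p(r,s)$ with $p$ smooth. The Riemann curvature tensor of $G$ is (subscripts denote partial derivatives) $$R^i_{\ k}=2G^i_{x^k}-G^i_{x^jy^k}y^j+2G^jG^i_{y^jy^k}-G^i_{y^j}G^j_{y^k}.$$ $G$ is of scalar curvature if $R^i_{\ k}=R\,\delta^i_k-\tau_ky^i$ for some $R=R(x,y)$, $\tau_k=\tau_k(x,y)$ with $R=\tau_ky^k$; it is of isotropic curvature if moreover $\tau_k=\frac12R_{y^k}$. (Then $R=\frac1{n-1}R^m_{\ m}$.) $G$ has zero curvature if $R^i_{\ k}=0$. In the integral formula, $\int\frac{u(r-s^2)}{s^2}\,ds$ denotes an antiderivative in $s$ for fixed $r$. *)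

(* Defs.v *)
From HB Require Import structures.
From mathcomp Require Import all_boot all_order all_algebra.
From mathcomp Require Import all_classical all_reals all_analysis.

Set Implicit Arguments.
Unset Strict Implicit.
Unset Printing Implicit Defensive.

Import Order.TTheory GRing.Theory Num.Theory.
Import numFieldNormedType.Exports.

Local Open Scope classical_set_scope.
Local Open Scope ring_scope.

Section Smoothness.
Variables (R : realType) (V : normedModType R).

Definition iter_derive (vs : seq V) (f : V -> R) : V -> R :=
  foldr (fun (v : V) (g : V -> R) => fun x => 'D_v g x) f vs.

(* [D] need not be open: [f] is then required to be C^oo on some open
   neighbourhood of [D].  In finite dimension, C^oo on an open set means that
   all the iterated directional derivatives are (Frechet) differentiable. *)
Definition smooth_on (D : set V) (f : V -> R) : Prop :=
  exists U : set V, [/\ open U, D `<=` U &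
    forall (vs : seq V) (x : V), U x -> differentiable (iter_derive vs f) x].

End Smoothness.

(* The canonical norm of ['rV[R]_n] in the library is the sup norm, whence the
   explicit Euclidean inner product, norm and balls. *)
Section Euclidean.
Variables (R : realType) (n : nat).

Definition dotp (x y : 'rV[R]_n) : R := \sum_(i < n) x 0 i * y 0 i.

Definition enorm (x : 'rV[R]_n) : R := Num.sqrt (dotp x x).

Definition eball (rho : R) : set 'rV[R]_n := [set x | enorm x < rho].

Definition slit (Omega : set 'rV[R]_n) : set ('rV[R]_n * 'rV[R]_n) :=
  [set z | Omega z.1 /\ z.2 != 0].

Definition rs_of (z : 'rV[R]_n * 'rV[R]_n) : R * R :=
  (enorm z.1 ^+ 2, dotp z.1 z.2 / enorm z.2).

(* For [2 <= n] and [Omega] the ball of radius [rho], [rs_dom Omega] is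
   [{(r, s) | s^2 <= r < rho^2}] and [r_dom Omega] is [[0, rho^2[], which is
   also the range of [r - s^2] on [rs_dom Omega]. *)
Definition rs_dom (Omega : set 'rV[R]_n) : set (R * R) := rs_of @` slit Omega.

Definition r_dom (Omega : set 'rV[R]_n) : set R :=
  [set enorm x ^+ 2 | x in Omega].

End Euclidean.
Arguments eball {R} n rho.

Section Sprays.
Variables (R : realType) (n : nat).
Notation V := 'rV[R]_n.
Implicit Types (Omega : set V) (G : 'I_n -> V * V -> R) (p : R * R -> R).

Definition dx (k : 'I_n) (f : V * V -> R) (z : V * V) : R :=
  'D_((delta_mx 0 k : V), (0 : V)) f z.

Definition dy (k : 'I_n) (f : V * V -> R) (z : V * V) : R :=
  'D_((0 : V), (delta_mx 0 k : V)) f z.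

(* A spray is given by its coefficients [G i = G^i(x, y)]; their values outside
   [slit Omega] are irrelevant. *)
Definition is_spray Omega G : Prop :=
  (forall i, smooth_on (slit Omega) (G i)) /\
  (forall i (x y : V) (l : R), slit Omega (x, y) -> 0 < l ->
     G i (x, l *: y) = l ^+ 2 * G i (x, y)).

(* Vectors are rows: [x *m U^T] is [U x], and [U *m U^T = 1%:M] is [U \in O(n)]. *)
Definition spherically_symmetric Omega G : Prop :=
  forall U : 'M[R]_n, U *m U^T = 1%:M ->
  forall (i : 'I_n) (x y : V), slit Omega (x, y) ->
    G i (x *m U^T, y *m U^T) = \sum_(j < n) U i j * G j (x, y).

Definition projectively_flat Omega G : Prop :=
  exists P : V * V -> R,
    (forall (x y : V) (l : R), slit Omega (x, y) -> 0 < l ->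
       P (x, l *: y) = l * P (x, y)) /\
    (forall (i : 'I_n) (x y : V), slit Omega (x, y) ->
       G i (x, y) = P (x, y) * y 0 i).

Definition spray_coef p (i : 'I_n) (z : V * V) : R :=
  enorm z.2 * p (rs_of z) * z.2 0 i.

Definition sph_flat_spray Omega G p : Prop :=
  [/\ is_spray Omega G, spherically_symmetric Omega G,
      projectively_flat Omega G, smooth_on (rs_dom Omega) p &
      forall (i : 'I_n) z, slit Omega z -> G i z = spray_coef p i z].

Definition Riemann G (i k : 'I_n) (z : V * V) : R :=
  2 * dx k (G i) z
  - \sum_(j < n) dy k (dx j (G i)) z * z.2 0 j
  + 2 * \sum_(j < n) G j z * dy k (dy j (G i)) z
  - \sum_(j < n) dy j (G i) z * dy k (G j) z.

Definition scalar_curvature_with Omega G (S : V * V -> R)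
    (tau : 'I_n -> V * V -> R) : Prop :=
  forall z, slit Omega z ->
    (forall i k : 'I_n,
       Riemann G i k z = S z * (i == k)%:R - tau k z * z.2 0 i) /\
    S z = \sum_(k < n) tau k z * z.2 0 k.

Definition isotropic_curvature Omega G : Prop :=
  exists (S : V * V -> R) (tau : 'I_n -> V * V -> R),
    scalar_curvature_with Omega G S tau /\
    (forall (k : 'I_n) z, slit Omega z -> tau k z = 2^-1 * dy k S z).

Definition zero_curvature Omega G : Prop :=
  forall (i k : 'I_n) z, slit Omega z -> Riemann G i k z = 0.

(* [A r s] is a choice of [\int u (r - s^2) / s^2 ds].  The integrand is
   singular at [s = 0], so the constants of integration for [s < 0] and for
   [0 < s] are independent, and may depend arbitrarily on [r]; they have to be
   chosen so that [A r s * s] extends smoothly across [s = 0]. *)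
Definition integral_choice Omega (u : R -> R) (A : R -> R -> R) : Prop :=
  (forall r s : R, rs_dom Omega (r, s) -> s != 0 ->
     is_derive s 1 (A r) (u (r - s ^+ 2) / s ^+ 2)) /\
  (exists q : R * R -> R, smooth_on (rs_dom Omega) q /\
     forall r s : R, rs_dom Omega (r, s) -> s != 0 -> q (r, s) = A r s * s).

(* The formula is only meaningful for [s != 0]; the values of a smooth [p] at
   [s = 0] are determined by continuity. *)
Definition integral_form Omega (u v : R -> R) p : Prop :=
  exists A : R -> R -> R, integral_choice Omega u A /\
    forall r s : R, rs_dom Omega (r, s) -> s != 0 ->
      p (r, s) = (A r s + v r) * s.

End Sprays.

Section FlatSolutions.
Variable R : realType.

(* In both definitions [b : bool] encodes the sign: [(-1) ^+ false = 1] is the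
   upper sign and [(-1) ^+ true = -1] the lower one. *)
Definition zero_curv_p (b : bool) (c : R) (rs : R * R) : R :=
  (rs.2 + (-1) ^+ b * Num.sqrt (rs.2 ^+ 2 - rs.1 + c)) / (c - rs.1).

Definition zero_curv_u (b : bool) (c : R) (t : R) : R :=
  - (-1) ^+ b / Num.sqrt (c - t).

End FlatSolutions.

(* Main.v *)
(* Write the coefficients as [P y^i] with [P = |y| p(r, s)] and set
   [Q := P_(x^j) y^j].  Euler's identity reduces the curvature to
     R^i_k = (P^2 - Q) delta^i_k - (P P_(y^k) + Q_(y^k) - 3 P_(x^k)) y^i,
   so isotropy means [Q_(y^k) = 2 P_(x^k)], that is [2 p_r = 2 s p_rs + p_ss],
   first where [s^2 < r], then everywhere by density.  This equation says that
   [p - s p_s] is constant along the curves [r - s^2 = t], hence equal to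
   [- u (r - s^2)] with [u t = - p(t, 0)], which is the integral formula since
   [(p / s)_s = - (p - s p_s) / s^2].  Zero curvature means [2 p_r = p p_s] and
   [p_s + s p p_s = p^2]; then [phi t = p(t, 0)] solves [phi' = phi^3 / 2] and
   [p (1 - s w) = w] with [w = phi (r - s^2)].  Conversely, given [u] and [v],
   integration by parts gives the solution
     - u (r - s^2) - 2 s^2 \int_0^1 u' (r - s^2 x^2) dx + v(r) s,
   which is smooth across [s = 0]. *)

Require Import Defs.
From HB Require Import structures.
From mathcomp Require Import all_boot all_order all_algebra.
From mathcomp Require Import all_classical all_reals all_analysis.
From mathcomp Require Import ring lra.

Set Implicit Arguments.
Unset Strict Implicit.
Unset Printing Implicit Defensive.

Import Order.TTheory GRing.Theory Num.Theory.
Import numFieldNormedType.Exports.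

Local Open Scope classical_set_scope.
Local Open Scope ring_scope.

(** * Smooth functions *)

(** The domain [s^2 <= r] of the profile is not open: at points with [s^2 = r], where [x] and [y]
    are parallel, the derivatives of [p] are those of an extension to an open set. Precisely there
    the vector [x - s y / |y|], through which the isotropy equation is extracted from the curvature,
    vanishes. Hence the equations are read off where [s^2 < r], on explicit vectors of a coordinate
    plane, and continuity of the derivatives of the extension does the rest. In the converse, the
    integral of [u' (r - sigma^2)] over [sigma] from [0] to [s] is rescaled to the fixed interval
    from [0] to [1]. Nothing is divided by [s], and differentiation under the integral sign stays
    within one family of integrals with weights [x^m]. The equation for [phi] is not solved by
    separating variables, which would divide by [phi], but through the conserved expression
    [phi^2 (1 - phi(0)^2 t)]. It settles both the vanishing and the nonvanishing case, and bounds
    the domain. *)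

Section DirectionalCalculus.
Context {R : realType} {V : normedModType R}.
Implicit Types (f g : V -> R) (x v : V) (U : set V).

Lemma is_derive_diff f x v : differentiable f x -> is_derive x v f ('D_v f x).
Proof. by move=> df; exact/derivableP/diff_derivable. Qed.

Lemma derive_line f x v : 'D_v f x = 'D_1 (fun h : R => f (h *: v + x)) 0.
Proof.
rewrite /derive; set g1 := fun h => h^-1 *: _; set g2 := fun h => h^-1 *: _.
suff -> : g1 = g2 by [].
by rewrite funeqE /g1 /g2 => h /=; rewrite addr0 scale0r add0r [_%:A]mulr1.
Qed.

Lemma is_derive_line f x v df :
  is_derive x v f df <-> is_derive (0 : R) (1 : R) (fun h : R => f (h *: v + x)) df.
Proof.
split=> -[Df <-]; (split; [exact/(derivable1P f x v) | by rewrite derive_line]).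
Qed.

Lemma derive_pair (p : R * R -> R) z (a b : R) : differentiable p z ->
  'D_(a, b) p z = a * 'D_(1, 0) p z + b * 'D_(0, 1) p z.
Proof.
move=> dp; rewrite !deriveE//.
have -> : (a, b) = a *: (1, 0) + b *: (0, 1) :> R * R.
  by congr pair; rewrite /= ?scaler0 ?addr0 ?add0r [_ *: _]mulr1.
by rewrite linearD !linearZ.
Qed.

(** Only derivability in the direction [v] is asked of [f] and [g]: on the line [h *: v + x] both
    become functions of one real variable, for which derivability and differentiability agree. *)
Lemma is_derive_comp2 (p : R * R -> R) f g x v df dg :
  differentiable p (f x, g x) -> is_derive x v f df -> is_derive x v g dg ->
  is_derive x v (fun y => p (f y, g y))
    (df * 'D_(1, 0) p (f x, g x) + dg * 'D_(0, 1) p (f x, g x)).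
Proof.
move=> dp /is_derive_line[fd fE] /is_derive_line[gd gE].
have f0 : f (0 *: v + x) = f x by rewrite scale0r add0r.
have g0 : g (0 *: v + x) = g x by rewrite scale0r add0r.
move/derivable1_diffP : fd => fd; move/derivable1_diffP : gd => gd.
have dc := differentiable_pair fd gd.
apply/is_derive_line.
have dp' : differentiable p
    ((fun h : R => (f (h *: v + x), g (h *: v + x))) 0) by rewrite f0 g0.
split.
  apply: diff_derivable.
  exact: (@differentiable_comp _ _ _ _ (fun h : R => (f (h *: v + x), g (h *: v + x))) p).
rewrite deriveE; last exact: (@differentiable_comp _ _ _ _
  (fun h : R => (f (h *: v + x), g (h *: v + x))) p).
have -> := @diff_comp _ _ _ _
  (fun h : R => (f (h *: v + x), g (h *: v + x))) p 0 dc dp'.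
rewrite /= diff_pair//.
have -> : 'd (fun h : R => f (h *: v + x)) 0 1 = df by rewrite -deriveE.
have -> : 'd (fun h : R => g (h *: v + x)) 0 1 = dg by rewrite -deriveE.
rewrite f0 g0 -deriveE; last exact: dp.
exact: derive_pair.
Qed.

Lemma is_derive_comp1 (p : R -> R) f x v df dp :
  is_derive (f x) 1 p dp -> is_derive x v f df ->
  is_derive x v (fun y => p (f y)) (df * dp).
Proof.
move=> Dp /is_derive_line Df; apply/is_derive_line; rewrite mulrC.
apply: (@is_derive1_comp _ p (fun h : R => f (h *: v + x))) => //.
by rewrite scale0r add0r.
Qed.

Lemma is_derive_inv f x v df : f x != 0 -> is_derive x v f df ->
  is_derive x v (fun y => (f y)^-1) (- df / f x ^+ 2).
Proof.
move=> f0 [Df <-]; split; first exact: derivableV.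
by rewrite deriveV// [LHS]mulNr mulNr mulrC.
Qed.

(** In [g = f + (g - f)] the second summand vanishes near [x], so the zero map is its
    differential. *)
Lemma near_eq_differentiable f g x :
  (\forall y \near x, f y = g y) -> differentiable f x -> differentiable g x.
Proof.
move=> fg df; have -> : g = f + (g - f) by rewrite addrC subrK.
apply: differentiableD => //.
have h0 : \forall y \near (0 : V), (g - f) (y + x) = 0.
  have := near_shift 0 x (fun y => f y = g y); rewrite subr0 => e.
  move: fg; rewrite e; apply: filterS => y /= fgy.
  by rewrite /= -[(g - f) _]/(g _ - f _) fgy subrr.
have lin0 : continuous (0 : V -> R) by exact: cst_continuous.
have fx0 : (g - f) x = 0 by move: (nbhs_singleton h0); rewrite add0r.
have E : (g - f) \o shift x = cst ((g - f) x) + (\0 : {linear V -> R}) +o_ 0 id.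
  apply/eqaddoP => e e0; near=> y.
  have gf0 : (g - f) (y + x) = 0 by near: y.
  rewrite [X in `|X|](_ : _ = 0) ?normr0 ?mulr_ge0// ?ltW//.
  rewrite -[LHS]/((g - f) (y + x) - ((g - f) x + 0)).
  by rewrite gf0 fx0 addr0 subrr.
have dE := diff_unique lin0 E.
by apply/diff_locallyP; rewrite dE.
Unshelve. all: by end_near. Qed.

End DirectionalCalculus.

Section SmoothIn.
Context {R : realType} {V : normedModType R}.
Implicit Types (f g : V -> R) (x v : V) (U : set V).

(** The clause of [smooth_on] for a fixed set. Openness of [U] is assumed separately, where
    derivatives on [U] must depend only on the values on [U]. *)
Definition smooth_in U f : Prop :=
  forall (vs : seq V) x, U x -> differentiable (iter_derive vs f) x.

Lemma smooth_in_diff U f x : smooth_in U f -> U x -> differentiable f x.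
Proof. by move=> sf; exact: (sf [::]). Qed.

Lemma smooth_in_derive U f v : smooth_in U f -> smooth_in U ('D_v f).
Proof.
move=> sf vs x Ux; have := sf (rcons vs v) x Ux.
by rewrite /iter_derive foldr_rcons.
Qed.

Lemma smooth_in_sub U U' f : U' `<=` U -> smooth_in U f -> smooth_in U' f.
Proof. by move=> sU sf vs x /sU; exact: sf. Qed.

Lemma open_near_eq U f g x : open U -> (forall y, U y -> f y = g y) -> U x ->
  \forall y \near x, f y = g y.
Proof. by move=> oU fg Ux; near=> y; apply: fg; near: y; exact: open_nbhs_nbhs.
Unshelve. all: by end_near. Qed.

Lemma iter_derive_eq U f g vs : open U -> (forall y, U y -> f y = g y) ->
  forall x, U x -> iter_derive vs f x = iter_derive vs g x.
Proof.
move=> oU fg; elim: vs => [|v vs IH] x Ux /=; first exact: fg.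
by apply: near_eq_derive; exact: open_near_eq Ux.
Qed.

Lemma smooth_in_eq U f g : open U -> (forall y, U y -> f y = g y) ->
  smooth_in U f -> smooth_in U g.
Proof.
move=> oU fg sf vs x Ux; apply: near_eq_differentiable (sf vs x Ux).
exact: (open_near_eq oU (iter_derive_eq _ oU fg)).
Qed.

(** The last vector of the list is the first one to act on [f], so the induction peels the list from
    the right and replaces [f] by another member of the class. *)
Lemma smooth_in_coind (F : (V -> R) -> Prop) U : open U ->
  (forall f x, F f -> U x -> differentiable f x) ->
  (forall f v, F f -> exists2 g, F g & forall x, U x -> 'D_v f x = g x) ->
  forall f, F f -> smooth_in U f.
Proof.
move=> oU dF DF f Ff vs; elim/last_ind: vs f Ff => [|vs v IH] f Ff x Ux.
  exact: dF.
have [g Fg gE] := DF f v Ff.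
rewrite /iter_derive foldr_rcons -/(iter_derive _ _).
apply: near_eq_differentiable (IH g Fg x Ux).
by apply: (open_near_eq oU _ Ux) => y Uy; apply: iter_derive_eq Uy => // ? /gE.
Qed.

(* Closing the smooth functions under the operations below gives a class that is
   stable under directional derivatives, hence, by coinduction, consists of
   smooth functions: no Leibniz or Faa di Bruno formula is needed. *)
Inductive smooth_gen U : (V -> R) -> Prop :=
| gen_smooth f : smooth_in U f -> smooth_gen U f
| gen_add f g : smooth_gen U f -> smooth_gen U g -> smooth_gen U (fun x => f x + g x)
| gen_mul f g : smooth_gen U f -> smooth_gen U g -> smooth_gen U (fun x => f x * g x)
| gen_inv f : smooth_gen U f -> (forall x, U x -> f x != 0) ->
    smooth_gen U (fun x => (f x)^-1)
| gen_sqrt f : smooth_gen U f -> (forall x, U x -> 0 < f x) ->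
    smooth_gen U (fun x => Num.sqrt (f x))
| gen_comp1 (p : R -> R) (W : set R) f : open W ->
    (forall (vs : seq R) t, W t -> differentiable (iter_derive vs p) t) ->
    smooth_gen U f -> (forall x, U x -> W (f x)) ->
    smooth_gen U (fun x => p (f x))
| gen_comp2 (p : R * R -> R) (W : set (R * R)) f g : open W ->
    (forall (vs : seq (R * R)) t, W t -> differentiable (iter_derive vs p) t) ->
    smooth_gen U f -> smooth_gen U g -> (forall x, U x -> W (f x, g x)) ->
    smooth_gen U (fun x => p (f x, g x)).

Lemma iter_derive_cst (c : R) vs : exists c', iter_derive vs (cst c : V -> R) = cst c'.
Proof.
elim: vs => [|v vs [c' IH]] /=; first by exists c.
by exists 0; rewrite /= IH; apply/funext => x; exact: derive_cst.
Qed.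

Lemma smooth_in_cst U (c : R) : smooth_in U (fun=> c).
Proof.
move=> vs x _; have [c' ->] := iter_derive_cst c vs; exact: differentiable_cst.
Qed.

Lemma smooth_in_linear U (f : {linear V -> R}) : continuous f -> smooth_in U f.
Proof.
move=> cf; elim/last_ind => [|vs v _] x Ux; first exact: linear_differentiable.
rewrite /iter_derive foldr_rcons.
have -> : (fun x => 'D_v f x) = cst (f v).
  by apply/funext => y; rewrite deriveE ?diff_lin//; exact: linear_differentiable.
exact: smooth_in_cst Ux.
Qed.

Lemma smooth_gen_diff U f x : smooth_gen U f -> U x -> differentiable f x.
Proof.
move=> gf Ux; elim: gf => {f}.
- by move=> f sf; exact: smooth_in_diff Ux.
- by move=> f g _ df _ dg; exact: differentiableD.
- by move=> f g _ df _ dg; exact: differentiableM.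
- by move=> f _ df f0; apply: differentiableV => //; exact: f0.
- move=> f _ df f0; apply: (differentiable_comp df).
  by apply/derivable1_diffP; have [] := is_derive1_sqrt (f0 x Ux).
- move=> p W f oW sp _ df fW; apply: (differentiable_comp df).
  exact: sp [::] _ (fW _ Ux).
- move=> p W f g oW sp _ df _ dg fW.
  apply: (@differentiable_comp _ _ _ _ (fun y => (f y, g y)) p).
    exact: differentiable_pair.
  exact: sp [::] _ (fW _ Ux).
Qed.

Lemma smooth_gen_opp U f : smooth_gen U f -> smooth_gen U (fun x => - f x).
Proof.
move=> gf; have -> : (fun x => - f x) = (fun x => -1 * f x).
  by apply/funext => x; rewrite mulN1r.
by apply: gen_mul => //; apply: gen_smooth; exact: smooth_in_cst.
Qed.

Lemma smooth_gen_derive U f v : smooth_gen U f ->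
  exists2 g, smooth_gen U g & forall x, U x -> 'D_v f x = g x.
Proof.
elim => {f}.
- by move=> f sf; exists ('D_v f) => //; apply: gen_smooth; exact: smooth_in_derive.
- move=> f g gf [f' gf' f'E] gg [g' gg' g'E].
  exists (fun x => f' x + g' x); first exact: gen_add.
  move=> x Ux; rewrite -f'E// -g'E//; apply: deriveD; apply: diff_derivable;
    exact: smooth_gen_diff Ux.
- move=> f g gf [f' gf' f'E] gg [g' gg' g'E].
  exists (fun x => f x * g' x + g x * f' x).
    by apply: gen_add; exact: gen_mul.
  move=> x Ux; rewrite -f'E// -g'E//; apply: deriveM; apply: diff_derivable;
    exact: smooth_gen_diff Ux.
- move=> f gf [f' gf' f'E] f0.
  (* The square is a product of two inverses, because the class is generated by products and has no
     constructor for powers. *)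
  exists (fun x => - f' x * ((f x)^-1 * (f x)^-1)).
    by apply: gen_mul; [exact: smooth_gen_opp | apply: gen_mul; exact: gen_inv].
  move=> x Ux; rewrite -f'E// -invfM -expr2; apply: derive_val.
  by apply: is_derive_inv (f0 x Ux) _; apply: is_derive_diff (smooth_gen_diff gf Ux).
- move=> f gf [f' gf' f'E] f0.
  exists (fun x => f' x * (2 * Num.sqrt (f x))^-1).
    apply: gen_mul => //; apply: gen_inv; first apply: gen_mul.
    + by apply: gen_smooth; exact: smooth_in_cst.
    + exact: gen_sqrt.
    + by move=> x Ux; rewrite mulf_neq0// gt_eqF// sqrtr_gt0 f0.
  move=> x Ux; rewrite -f'E//; apply: derive_val.
  apply: (is_derive_comp1 (p := Num.sqrt)); first exact: is_derive1_sqrt (f0 x Ux).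
  exact: is_derive_diff (smooth_gen_diff gf Ux).
- move=> p W f oW sp gf [f' gf' f'E] fW.
  exists (fun x => f' x * 'D_1 p (f x)).
    apply: gen_mul => //; apply: (@gen_comp1 U ('D_1 p) W) => //.
    by move=> vs t Wt; have := sp (rcons vs 1) t Wt; rewrite /iter_derive foldr_rcons.
  move=> x Ux; rewrite -f'E//; apply: derive_val.
  apply: is_derive_comp1; last exact: is_derive_diff (smooth_gen_diff gf Ux).
  exact: is_derive_diff (sp [::] _ (fW _ Ux)).
- move=> p W f g oW sp gf [f' gf' f'E] gg [g' gg' g'E] fW.
  exists (fun x => f' x * 'D_(1, 0) p (f x, g x) + g' x * 'D_(0, 1) p (f x, g x)).
    apply: gen_add; apply: gen_mul => //.
    + apply: (@gen_comp2 U ('D_(1, 0) p) W) => // vs t Wt.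
      by have := sp (rcons vs (1, 0)) t Wt; rewrite /iter_derive foldr_rcons.
    + apply: (@gen_comp2 U ('D_(0, 1) p) W) => // vs t Wt.
      by have := sp (rcons vs (0, 1)) t Wt; rewrite /iter_derive foldr_rcons.
  move=> x Ux; rewrite -f'E// -g'E//; apply: derive_val.
  apply: is_derive_comp2; first exact: sp [::] _ (fW _ Ux).
    exact: is_derive_diff (smooth_gen_diff gf Ux).
  exact: is_derive_diff (smooth_gen_diff gg Ux).
Qed.

Lemma smooth_gen_smooth U f : open U -> smooth_gen U f -> smooth_in U f.
Proof.
move=> oU; apply: (@smooth_in_coind (smooth_gen U)) => //.
  by move=> {}f x; exact: smooth_gen_diff.
by move=> {}f v; exact: smooth_gen_derive.
Qed.

End SmoothIn.

Section SmoothClosure.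
Context {R : realType} {V : normedModType R}.
Implicit Types (f g : V -> R) (U : set V).

Lemma smooth_inD U f g : open U -> smooth_in U f -> smooth_in U g ->
  smooth_in U (fun x => f x + g x).
Proof.
by move=> oU sf sg; apply: (smooth_gen_smooth oU); apply: gen_add; exact: gen_smooth.
Qed.

Lemma smooth_inM U f g : open U -> smooth_in U f -> smooth_in U g ->
  smooth_in U (fun x => f x * g x).
Proof.
by move=> oU sf sg; apply: (smooth_gen_smooth oU); apply: gen_mul; exact: gen_smooth.
Qed.

Lemma smooth_inN U f : open U -> smooth_in U f -> smooth_in U (fun x => - f x).
Proof.
by move=> oU sf; apply: (smooth_gen_smooth oU); apply: smooth_gen_opp; exact: gen_smooth.
Qed.

Lemma smooth_inB U f g : open U -> smooth_in U f -> smooth_in U g ->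
  smooth_in U (fun x => f x - g x).
Proof. by move=> oU sf sg; apply: smooth_inD => //; exact: smooth_inN. Qed.

Lemma smooth_inV U f : open U -> smooth_in U f -> (forall x, U x -> f x != 0) ->
  smooth_in U (fun x => (f x)^-1).
Proof.
by move=> oU sf f0; apply: (smooth_gen_smooth oU); apply: gen_inv => //; exact: gen_smooth.
Qed.

Lemma smooth_in_sqrt U f : open U -> smooth_in U f -> (forall x, U x -> 0 < f x) ->
  smooth_in U (fun x => Num.sqrt (f x)).
Proof.
by move=> oU sf f0; apply: (smooth_gen_smooth oU); apply: gen_sqrt => //; exact: gen_smooth.
Qed.

Lemma smooth_in_comp1 U (p : R -> R) (W : set R) f : open U -> open W ->
  smooth_in W p -> smooth_in U f -> (forall x, U x -> W (f x)) ->
  smooth_in U (fun x => p (f x)).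
Proof.
move=> oU oW sp sf fW; apply: (smooth_gen_smooth oU).
by apply: (gen_comp1 oW) => //; exact: gen_smooth.
Qed.

Lemma smooth_in_comp2 U (p : R * R -> R) (W : set (R * R)) f g : open U -> open W ->
  smooth_in W p -> smooth_in U f -> smooth_in U g ->
  (forall x, U x -> W (f x, g x)) ->
  smooth_in U (fun x => p (f x, g x)).
Proof.
move=> oU oW sp sf sg fW; apply: (smooth_gen_smooth oU).
by apply: (gen_comp2 oW) => //; exact: gen_smooth.
Qed.

Lemma smooth_in_sum U (I : Type) (s : seq I) (f : I -> V -> R) : open U ->
  (forall i, smooth_in U (f i)) -> smooth_in U (fun x => \sum_(i <- s) f i x).
Proof.
move=> oU sf; elim: s => [|i s IH].
  apply: (smooth_in_eq oU _ (smooth_in_cst (U := U) 0)) => x _.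
  by rewrite big_nil.
apply: (smooth_in_eq oU _ (smooth_inD oU (sf i) IH)) => x _.
by rewrite big_cons.
Qed.

Lemma smooth_in_lin U f : linear f -> continuous f -> smooth_in U f.
Proof.
move=> lf cf; pose fM := GRing.isLinear.Build _ _ _ _ _ lf.
by pose fL : {linear V -> R} := HB.pack f fM; exact: (@smooth_in_linear _ _ U fL).
Qed.

Lemma smooth_in_continuous U f x : smooth_in U f -> U x -> {for x, continuous f}.
Proof. by move=> sf Ux; apply: differentiable_continuous (smooth_in_diff sf Ux). Qed.

Lemma is_derive_lin f x v : linear f -> continuous f -> is_derive x v f (f v).
Proof.
move=> lf cf; pose fM := GRing.isLinear.Build _ _ _ _ _ lf.
pose fL : {linear V -> R} := HB.pack f fM.
have df : differentiable fL x by exact: linear_differentiable.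
split; first exact: diff_derivable df.
by rewrite (deriveE _ df) diff_lin.
Qed.

Lemma is_derive_add f g x v df dg : is_derive x v f df -> is_derive x v g dg ->
  is_derive x v (fun y => f y + g y) (df + dg).
Proof. by move=> Df Dg; exact: is_deriveD. Qed.

Lemma is_derive_opp f x v df : is_derive x v f df ->
  is_derive x v (fun y => - f y) (- df).
Proof. by move=> Df; exact: is_deriveN. Qed.

Lemma is_derive_sub f g x v df dg : is_derive x v f df -> is_derive x v g dg ->
  is_derive x v (fun y => f y - g y) (df - dg).
Proof. by move=> Df Dg; exact: is_deriveB. Qed.

Lemma is_derive_mul f g x v df dg : is_derive x v f df -> is_derive x v g dg ->
  is_derive x v (fun y => f y * g y) (df * g x + f x * dg).
Proof.
by move=> Df Dg; apply: is_derive_eq (is_deriveM Df Dg) _; rewrite addrC [_ *: df]mulrC.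
Qed.

Lemma is_derive_bigsum n (f : 'I_n -> V -> R) x v (df : 'I_n -> R) :
  (forall i, is_derive x v (f i) (df i)) ->
  is_derive x v (fun y => \sum_(i < n) f i y) (\sum_(i < n) df i).
Proof.
by move=> Df; have := is_derive_sum Df; rewrite fct_sumE.
Qed.

End SmoothClosure.

Section Pairs.
Context {R : realType} {V W : normedModType R}.

Lemma smooth_in_fst (U : set (V * W)) (f : V -> R) : linear f -> continuous f ->
  smooth_in U (fun z => f z.1).
Proof.
move=> lf cf; apply: smooth_in_lin; first by move=> a x y /=; rewrite lf.
by move=> z; apply: (continuous_comp (@cvg_fst _ _ _ _ _)); exact: cf.
Qed.

Lemma smooth_in_snd (U : set (V * W)) (f : W -> R) : linear f -> continuous f ->
  smooth_in U (fun z => f z.2).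
Proof.
move=> lf cf; apply: smooth_in_lin; first by move=> a x y /=; rewrite lf.
by move=> z; apply: (continuous_comp (@cvg_snd _ _ _ _ _)); exact: cf.
Qed.

Lemma is_derive_fst (f : V -> R) (z v : V * W) : linear f -> continuous f ->
  is_derive z v (fun z => f z.1) (f v.1).
Proof.
move=> lf cf; apply: (@is_derive_lin _ _ (fun z : V * W => f z.1)).
  by move=> a x y /=; rewrite lf.
by move=> y; apply: (continuous_comp (@cvg_fst _ _ _ _ _)); exact: cf.
Qed.

Lemma is_derive_snd (f : W -> R) (z v : V * W) : linear f -> continuous f ->
  is_derive z v (fun z => f z.2) (f v.2).
Proof.
move=> lf cf; apply: (@is_derive_lin _ _ (fun z : V * W => f z.2)).
  by move=> a x y /=; rewrite lf.
by move=> y; apply: (continuous_comp (@cvg_snd _ _ _ _ _)); exact: cf.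
Qed.

End Pairs.

Section RealPairs.
Context {R : realType}.

Lemma smooth_in_r (U : set (R * R)) : smooth_in U (fun z => z.1).
Proof. by apply: (@smooth_in_fst _ _ _ _ idfun) => // x. Qed.

Lemma smooth_in_s (U : set (R * R)) : smooth_in U (fun z => z.2).
Proof. by apply: (@smooth_in_snd _ _ _ _ idfun) => // x. Qed.

Lemma is_derive_r (z v : R * R) : is_derive z v (fun z => z.1) v.1.
Proof. by apply: (@is_derive_fst _ _ _ idfun) => // x. Qed.

Lemma is_derive_s (z v : R * R) : is_derive z v (fun z => z.2) v.2.
Proof. by apply: (@is_derive_snd _ _ _ idfun) => // x. Qed.

End RealPairs.

(* The two partial derivatives are locked: telling ['D_(1, 0) p] from ['D_(0, 1) p]
   by unification would compare [1] and [0] in [R], which does not terminate in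
   reasonable time. *)
HB.lock Definition der_r (R : realType) (f : R * R -> R) : R * R -> R :=
  fun z => 'D_(1, 0) f z.

HB.lock Definition der_s (R : realType) (f : R * R -> R) : R * R -> R :=
  fun z => 'D_(0, 1) f z.

Section PartialDerivatives.
Context {R : realType}.
Implicit Types (p : R * R -> R) (U : set (R * R)).

Lemma smooth_in_der_r U p : smooth_in U p -> smooth_in U (der_r p).
Proof. by rewrite der_r.unlock; exact: smooth_in_derive. Qed.

Lemma smooth_in_der_s U p : smooth_in U p -> smooth_in U (der_s p).
Proof. by rewrite der_s.unlock; exact: smooth_in_derive. Qed.

Lemma is_derive_partials {V : normedModType R} p (f g : V -> R) x v df dg :
  differentiable p (f x, g x) -> is_derive x v f df -> is_derive x v g dg ->
  is_derive x v (fun y => p (f y, g y))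
    (df * der_r p (f x, g x) + dg * der_s p (f x, g x)).
Proof. by rewrite der_r.unlock der_s.unlock; exact: is_derive_comp2. Qed.

Lemma der_r_eq U p q z : open U -> (forall y, U y -> p y = q y) -> U z ->
  der_r p z = der_r q z.
Proof.
move=> oU pq Uz; rewrite der_r.unlock; apply: near_eq_derive.
exact: open_near_eq oU pq Uz.
Qed.

Lemma der_s_eq U p q z : open U -> (forall y, U y -> p y = q y) -> U z ->
  der_s p z = der_s q z.
Proof.
move=> oU pq Uz; rewrite der_s.unlock; apply: near_eq_derive.
exact: open_near_eq oU pq Uz.
Qed.

End PartialDerivatives.

(** * Derivatives of the Euclidean invariants *)

Section EuclideanGeometry.
Context {R : realType} {n : nat}.
Notation V := 'rV[R]_n.
Implicit Types (x y : V) (z v : V * V) (i k : 'I_n).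

Lemma coord_linear i : linear (fun x : V => x 0 i : R).
Proof. by move=> a x y; rewrite !mxE. Qed.

Lemma coord_cont i : continuous (fun x : V => x 0 i : R).
Proof. exact: coord_continuous. Qed.

Lemma dotpC x y : dotp x y = dotp y x.
Proof. by apply: eq_bigr => i _; rewrite mulrC. Qed.

Lemma dotpDl x x' y : dotp (x + x') y = dotp x y + dotp x' y.
Proof. by rewrite /dotp -big_split/=; apply: eq_bigr => i _; rewrite mxE mulrDl. Qed.

Lemma dotpZl a x y : dotp (a *: x) y = a * dotp x y.
Proof. by rewrite /dotp mulr_sumr; apply: eq_bigr => i _; rewrite mxE mulrA. Qed.

Lemma dotpZr a x y : dotp x (a *: y) = a * dotp x y.
Proof. by rewrite dotpC dotpZl dotpC. Qed.

Lemma dotp0l x : dotp 0 x = 0.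
Proof. by rewrite /dotp big1// => i _; rewrite mxE mul0r. Qed.

Lemma dotp_ge0 x : 0 <= dotp x x.
Proof. by apply: sumr_ge0 => i _; rewrite -expr2 sqr_ge0. Qed.

Lemma dotp_gt0 x : (0 < dotp x x) = (x != 0).
Proof.
rewrite lt_def dotp_ge0 andbT; congr (~~ _); apply/eqP/eqP => [x0|->].
  apply/rowP => i; rewrite mxE; apply/eqP; rewrite -sqrf_eq0 expr2.
  apply/eqP; apply: (psumr_eq0P _ x0) => // j _.
  by rewrite -expr2 sqr_ge0.
exact: dotp0l.
Qed.

Lemma dotp_deltal k x : dotp (delta_mx 0 k) x = x 0 k.
Proof.
rewrite /dotp (bigD1 k)//= big1 ?addr0 => [|i ik].
  by rewrite mxE !eqxx mul1r.
by rewrite mxE (negbTE ik) andbF mul0r.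
Qed.

Lemma enorm_sqr x : enorm x ^+ 2 = dotp x x.
Proof. by rewrite sqr_sqrtr// dotp_ge0. Qed.

Lemma enorm_gt0 x : (0 < enorm x) = (x != 0).
Proof. by rewrite sqrtr_gt0 dotp_gt0. Qed.

Lemma enorm_neq0 x : x != 0 -> enorm x != 0.
Proof. by rewrite -enorm_gt0 => /lt0r_neq0. Qed.

Lemma enormZ a x : 0 < a -> enorm (a *: x) = a * enorm x.
Proof.
move=> a0; rewrite /enorm dotpZl dotpZr mulrA -expr2 sqrtrM ?sqr_ge0//.
by rewrite sqrtr_sqr gtr0_norm.
Qed.

Lemma dotp_sqr_le x y : dotp x y ^+ 2 <= dotp x x * dotp y y.
Proof.
have [->|y0] := eqVneq y 0; first by rewrite dotpC !dotp0l expr0n mulr0.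
have y0' : 0 < dotp y y by rewrite dotp_gt0.
rewrite -subr_ge0 -(pmulr_rge0 _ y0').
(* This vector is [dotp y y] times the component of [x] orthogonal to [y]; its squared norm is
   [dotp y y] times the difference to be shown nonnegative. *)
have := dotp_ge0 (dotp y y *: x + (- dotp x y) *: y).
rewrite !dotpDl !dotpZl ![dotp _ (_ + _)]dotpC !dotpDl !dotpZl.
by rewrite (dotpC y x); lra.
Qed.

Lemma smooth_in_coord1 (U : set (V * V)) i : smooth_in U (fun z => z.1 0 i).
Proof. exact: (@smooth_in_fst R V V U _ (coord_linear i) (@coord_cont i)). Qed.

Lemma smooth_in_coord2 (U : set (V * V)) i : smooth_in U (fun z => z.2 0 i).
Proof. exact: (@smooth_in_snd R V V U _ (coord_linear i) (@coord_cont i)). Qed.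

Lemma is_derive_coord1 z v i : is_derive z v (fun z => z.1 0 i) (v.1 0 i).
Proof. exact: (@is_derive_fst R V V _ z v (coord_linear i) (@coord_cont i)). Qed.

Lemma is_derive_coord2 z v i : is_derive z v (fun z => z.2 0 i) (v.2 0 i).
Proof. exact: (@is_derive_snd R V V _ z v (coord_linear i) (@coord_cont i)). Qed.

Lemma smooth_in_dotp (U : set (V * V)) (f g : 'I_n -> V * V -> R) : open U ->
  (forall i, smooth_in U (f i)) -> (forall i, smooth_in U (g i)) ->
  smooth_in U (fun z => \sum_(i < n) f i z * g i z).
Proof. by move=> oU sf sg; apply: smooth_in_sum => // i; exact: smooth_inM. Qed.

Lemma smooth_in_xx (U : set (V * V)) : open U -> smooth_in U (fun z => dotp z.1 z.1).
Proof. by move=> oU; apply: smooth_in_dotp => // i; exact: smooth_in_coord1. Qed.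

Lemma smooth_in_xy (U : set (V * V)) : open U -> smooth_in U (fun z => dotp z.1 z.2).
Proof.
move=> oU; apply: (smooth_in_dotp oU) => i.
  exact: smooth_in_coord1.
exact: smooth_in_coord2.
Qed.

Lemma smooth_in_yy (U : set (V * V)) : open U -> smooth_in U (fun z => dotp z.2 z.2).
Proof. by move=> oU; apply: (smooth_in_dotp oU) => i; exact: smooth_in_coord2. Qed.

Lemma is_derive_xx z v :
  is_derive z v (fun z => dotp z.1 z.1) (2 * dotp v.1 z.1).
Proof.
apply: is_derive_eq; first apply: is_derive_bigsum => i.
  by apply: is_derive_mul; exact: is_derive_coord1.
by rewrite /dotp mulr_sumr; apply: eq_bigr => i _; ring.
Qed.

Lemma is_derive_xy z v :
  is_derive z v (fun z => dotp z.1 z.2) (dotp v.1 z.2 + dotp v.2 z.1).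
Proof.
apply: is_derive_eq; first apply: is_derive_bigsum => i.
  by apply: is_derive_mul; [exact: is_derive_coord1 | exact: is_derive_coord2].
by rewrite /dotp -big_split; apply: eq_bigr => i _ /=; ring.
Qed.

Lemma is_derive_yy z v :
  is_derive z v (fun z => dotp z.2 z.2) (2 * dotp v.2 z.2).
Proof.
apply: is_derive_eq; first apply: is_derive_bigsum => i.
  by apply: is_derive_mul; exact: is_derive_coord2.
by rewrite /dotp mulr_sumr; apply: eq_bigr => i _; ring.
Qed.

Lemma is_derive_enorm2 z v : z.2 != 0 ->
  is_derive z v (fun z => enorm z.2) (dotp v.2 z.2 / enorm z.2).
Proof.
move=> y0; apply: is_derive_eq.
  apply: (is_derive_comp1 (p := Num.sqrt)); last exact: is_derive_yy.
  by apply: is_derive1_sqrt; rewrite dotp_gt0.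
by rewrite -/(enorm z.2); field; rewrite enorm_neq0.
Qed.

Lemma is_derive_rs1 z v : is_derive z v (fun z => (rs_of z).1) (2 * dotp v.1 z.1).
Proof.
have -> : (fun z => (rs_of z).1) = (fun z : V * V => dotp z.1 z.1).
  by apply/funext => y /=; rewrite enorm_sqr.
exact: is_derive_xx.
Qed.

Lemma is_derive_rs2 z v : z.2 != 0 ->
  is_derive z v (fun z => (rs_of z).2)
    ((dotp v.1 z.2 + dotp v.2 z.1) / enorm z.2
     - (rs_of z).2 * dotp v.2 z.2 / enorm z.2 ^+ 2).
Proof.
move=> y0; apply: is_derive_eq.
  apply: is_derive_mul; first exact: is_derive_xy.
  by apply: is_derive_inv; [exact: enorm_neq0 | exact: is_derive_enorm2].
by rewrite /=; field; rewrite enorm_neq0.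
Qed.

Lemma is_derive_rs (f : R * R -> R) z v : z.2 != 0 -> differentiable f (rs_of z) ->
  is_derive z v (fun z => f (rs_of z))
   (2 * dotp v.1 z.1 * der_r f (rs_of z) +
    ((dotp v.1 z.2 + dotp v.2 z.1) / enorm z.2
     - (rs_of z).2 * dotp v.2 z.2 / enorm z.2 ^+ 2) * der_s f (rs_of z)).
Proof.
move=> y0 df.
apply: (@is_derive_partials _ _ f (fun z => (rs_of z).1) (fun z => (rs_of z).2)) => //.
  exact: is_derive_rs1.
exact: is_derive_rs2.
Qed.

End EuclideanGeometry.

(** * Symmetry of mixed derivatives *)

Section MixedDerivatives.
Context {R : realType}.

Lemma MVT_cc (f df : R -> R) (a b : R) : a < b ->
  (forall x, a <= x <= b -> is_derive x 1 f (df x)) ->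
  exists2 c, a < c < b & f b - f a = df c * (b - a).
Proof.
move=> ab Df; have [||c] := @MVT R f df a b ab.
- by move=> x; rewrite in_itv/= => /andP[/ltW ax /ltW xb]; apply: Df; rewrite ax.
- apply: derivable_within_continuous => x; by rewrite in_itv/= => /Df [].
by rewrite in_itv/=; exists c.
Qed.

Lemma derive0_cst_cc (f : R -> R) (s : R) :
  (forall x : R, `|x| <= `|s| -> is_derive x (1 : R) f 0) -> f s = f 0.
Proof.
move=> Df; apply/eqP; have [s0|s0|->//] := ltgtP s 0.
- have [|c _ /eqP] := @MVT_cc f (fun=> 0) s 0 s0.
    move=> x /andP[sx x0]; apply: Df.
    by rewrite (ler0_norm x0) (ltr0_norm s0) lerN2.
  by rewrite mul0r subr_eq0 eq_sym.
- have [|c _ /eqP] := @MVT_cc f (fun=> 0) 0 s s0.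
    move=> x /andP[x0 xs]; apply: Df.
    by rewrite (ger0_norm x0) (gtr0_norm s0).
  by rewrite mul0r subr_eq0.
Qed.

Context {V : normedModType R}.
Implicit Types (f : V -> R) (v w c z : V).

Lemma is_derive_ray f v c (t : R) : differentiable f (t *: v + c) ->
  is_derive t (1 : R) (fun t : R => f (t *: v + c)) ('D_v f (t *: v + c)).
Proof.
move=> df; apply/(@is_derive_line _ _ (fun t : R => f (t *: v + c))).
have -> : (fun h : R => f ((h *: (1 : R) + t) *: v + c)) =
          (fun h : R => f (h *: v + (t *: v + c))).
  by apply/funext => h; rewrite scalerDl -addrA [h *: 1]mulr1.
by apply/(@is_derive_line _ _ f _ v); exact: is_derive_diff.
Qed.

(** The mean value theorem is used twice: along [v] for the increment of [f] by [h *: w], then along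
    [w] for the derivative of [f] along [v]. The left-hand side is symmetric in [v] and [w], so it
    also equals a value of the other mixed derivative. *)
Lemma second_difference (U : set V) f (F : V -> R) v w z (h : R) : smooth_in U f ->
  'D_w ('D_v f) = F -> 0 < h ->
  (forall a b : R, 0 <= a <= h -> 0 <= b <= h -> U (a *: v + (b *: w + z))) ->
  exists a b : R, [/\ 0 < a < h, 0 < b < h &
    f (h *: v + (h *: w + z)) - f (h *: w + z) - (f (h *: v + z) - f z)
    = F (a *: v + (b *: w + z)) * h * h].
Proof.
move=> sf FE h0 Uh; have h00 : 0 <= (0 : R) <= h by apply/andP; split=> //; exact: ltW.
have hh : 0 <= h <= h by apply/andP; split=> //; exact: ltW.
have [|a /[dup] ah /andP[/ltW a0 /ltW a1]] := @MVT_cc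
    (fun t => f (t *: v + (h *: w + z)) - f (t *: v + z))
    (fun t => 'D_v f (t *: v + (h *: w + z)) - 'D_v f (t *: v + z)) 0 h h0.
  move=> t t0h; apply: is_derive_sub; apply: is_derive_ray; apply: smooth_in_diff sf _.
    exact: Uh.
  by have := Uh _ _ t0h h00; rewrite scale0r add0r.
rewrite !scale0r !add0r subr0 => Ea.
have ah' : 0 <= a <= h by rewrite a0 a1.
have [|b /[dup] bh /andP[/ltW b0 /ltW b1]] := @MVT_cc
    (fun t => 'D_v f (t *: w + (a *: v + z)))
    (fun t => 'D_w ('D_v f) (t *: w + (a *: v + z))) 0 h h0.
  move=> t t0h; apply: is_derive_ray; apply: smooth_in_diff (smooth_in_derive _ sf) _.
  by rewrite addrCA; exact: Uh.
rewrite !scale0r !add0r subr0 => Eb.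
exists a, b; split=> //.
have -> : F (a *: v + (b *: w + z)) = 'D_w ('D_v f) (b *: w + (a *: v + z)).
  by rewrite [a *: v + _]addrCA -FE.
rewrite -Eb -[f (h *: v + z) - _]opprB opprK.
by rewrite [_ + (a *: v + z)]addrCA -Ea; ring.
Qed.

Lemma nbhs_box (S : set V) v w z : nbhs z S -> exists2 h : R, 0 < h &
  forall a b : R, 0 <= a <= h -> 0 <= b <= h -> S (a *: v + (b *: w + z)).
Proof.
move=> nS; pose F (q : R * R) : V := q.1 *: v + (q.2 *: w + z).
have cF : F q @[q --> ((0, 0) : R * R)] --> z.
  have -> : z = 0 *: v + (0 *: w + z) by rewrite !scale0r !add0r.
  apply: cvgD; first by apply: cvgZr_tmp; exact: cvg_fst.
  by apply: cvgD; [apply: cvgZr_tmp; exact: cvg_snd | exact: cvg_cst].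
have nF : nbhs ((0, 0) : R * R) (F @^-1` S) by exact: cF.
have /nbhs_ballP[e /= e0 He] := nF.
exists (e / 2); first by rewrite divr_gt0.
move=> a b /andP[a0 a1] /andP[b0 b1]; apply: (He (a, b)).
by split; rewrite /ball/= sub0r normrN ger0_norm//; lra.
Qed.

(** In every small box at [z] the two mixed derivatives share a value, though at different points,
    since both compute the same second difference. If they differed by [d] at [z], continuity would
    keep each within [d / 2] of its value at [z], a contradiction. *)
Lemma derive_comm (U : set V) f v w z : open U -> smooth_in U f -> U z ->
  'D_v ('D_w f) z = 'D_w ('D_v f) z.
Proof.
move=> oU sf Uz.
have [f1 f1E] : exists f1, 'D_v ('D_w f) = f1 by eexists.
have [f2 f2E] : exists f2, 'D_w ('D_v f) = f2 by eexists.
have cA : {for z, continuous f1}.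
  by rewrite -f1E; apply: smooth_in_continuous (smooth_in_derive _ (smooth_in_derive _ sf)) Uz.
have cB : {for z, continuous f2}.
  by rewrite -f2E; apply: smooth_in_continuous (smooth_in_derive _ (smooth_in_derive _ sf)) Uz.
have E h : 0 < h -> (forall a b : R, 0 <= a <= h -> 0 <= b <= h ->
      U (a *: v + (b *: w + z))) ->
    exists a b a' b' : R, [/\ 0 < a < h, 0 < b < h, 0 < a' < h, 0 < b' < h &
      f2 (a *: v + (b *: w + z)) = f1 (a' *: v + (b' *: w + z))].
  move=> h0 Uh.
  have [a [b [ah bh E1]]] := second_difference sf f2E h0 Uh.
  have [|b' [a' [bh' ah' E2]]] := @second_difference U f f1 w v z h sf f1E h0.
    by move=> b' a' hb ha; rewrite addrCA; exact: Uh.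
  exists a, b, a', b'; apply: And5 ah bh ah' bh' _.
  have hn0 : h != 0 by rewrite gt_eqF.
  apply: (mulIf hn0); apply: (mulIf hn0).
  rewrite -E1 [a' *: v + _]addrCA -E2 [h *: w + (h *: v + z)]addrCA.
  by move: (f _) (f _) (f _) (f _) => *; ring.
suff : f1 z = f2 z by rewrite -f1E -f2E.
clear f1E f2E.
apply/eqP; rewrite -subr_eq0 -normr_le0 leNgt; apply/negP => d0.
set d := `|_| in d0; have d2 : 0 < d / 2 by rewrite divr_gt0.
have n1 : \forall x \near z, U x by exact: open_nbhs_nbhs.
have n2 : \forall x \near z, `|f1 z - f1 x| < d / 2.
  by move/cvgrPdist_lt : cA => /(_ _ d2).
have n3 : \forall x \near z, `|f2 z - f2 x| < d / 2.
  by move/cvgrPdist_lt : cB => /(_ _ d2).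
have [h h0 Hh] := nbhs_box v w (filterI n1 (filterI n2 n3)).
have [|a [b [a' [b' [/andP[a0 a1] /andP[b0 b1] /andP[a0' a1'] /andP[b0' b1'] EE]]]]] :=
    E h h0.
  by move=> a b ha hb; have [] := Hh a b ha hb.
have [|_ [_ SB]] := Hh a b _ ltac:(by rewrite (ltW b0) (ltW b1)).
  by rewrite (ltW a0) (ltW a1).
have [|_ [SA _]] := Hh a' b' _ ltac:(by rewrite (ltW b0') (ltW b1')).
  by rewrite (ltW a0') (ltW a1').
have : d < d / 2 + d / 2.
  rewrite {1}/d; apply: le_lt_trans (ltrD SA SB); rewrite EE.
  rewrite (distrC (f2 z)); apply: le_trans (ler_normD _ _).
  by rewrite addrA subrK.
by rewrite -splitr ltxx.
Qed.

End MixedDerivatives.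

Lemma der_rs_comm {R : realType} (U : set (R * R)) p z : open U -> smooth_in U p ->
  U z -> der_r (der_s p) z = der_s (der_r p) z.
Proof.
by move=> oU sp Uz; rewrite der_r.unlock der_s.unlock; exact: derive_comm oU sp Uz.
Qed.

(** * Curvature of a projectively flat spray *)

Section FlatCurvature.
Context {R : realType} {n : nat}.
Notation V := 'rV[R]_n.
Variables (Omega : set V) (G : 'I_n -> V * V -> R) (p : R * R -> R).
Variable U : set (R * R).
Hypothesis oO : open Omega.
Hypotheses (oU : open U) (DU : rs_dom Omega `<=` U) (sp : smooth_in U p).
Hypothesis GE : forall i z, slit Omega z -> G i z = spray_coef p i z.
Implicit Types (z v : V * V) (i j k : 'I_n).

Local Notation p1 := (der_r p).
Local Notation p2 := (der_s p).
Local Notation p12 := (der_s p1).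
Local Notation p22 := (der_s p2).
Local Notation N z := (enorm z.2).
Local Notation ex k := ((delta_mx 0 k : V), (0 : V)).
Local Notation ey k := ((0 : V), (delta_mx 0 k : V)).

Definition flatP z := N z * p (rs_of z).
Definition flatPx k z := 2 * N z * z.1 0 k * p1 (rs_of z) + z.2 0 k * p2 (rs_of z).
(** The factor [x^k - s y^k / |y|] is [|y|] times the derivative of [s] in [y^k]. It is the
    component of [x] orthogonal to [y]. *)
Definition flatPy k z := p (rs_of z) * z.2 0 k / N z
  + p2 (rs_of z) * (z.1 0 k - (rs_of z).2 * z.2 0 k / N z).
(* The derivative of [flatP] along the flow lines: [P_(x^j) y^j]. *)
Definition flatQ z := N z ^+ 2 * (2 * (rs_of z).2 * p1 (rs_of z) + p2 (rs_of z)).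
Definition flatQy k z :=
  2 * z.2 0 k * (2 * (rs_of z).2 * p1 (rs_of z) + p2 (rs_of z))
  + N z * (2 * p1 (rs_of z) + 2 * (rs_of z).2 * p12 (rs_of z) + p22 (rs_of z))
    * (z.1 0 k - (rs_of z).2 * z.2 0 k / N z).

Lemma open_slit : open (slit Omega).
Proof.
have -> : slit Omega = (fst @^-1` Omega) `&`
    ((fun z : V * V => dotp z.2 z.2) @^-1` [set t | t > 0]).
  by apply/seteqP; split=> z /=; rewrite dotp_gt0.
apply: openI.
  by apply: open_comp => // z _; exact: cvg_fst.
apply: open_comp; last exact: open_gt.
move=> z _; apply: (smooth_in_continuous (U := setT)) => //.
by apply: smooth_in_yy; exact: openT.
Qed.

Let U_rs z : slit Omega z -> U (rs_of z).
Proof. by move=> sz; apply: DU; exists z. Qed.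

Let N0 z : slit Omega z -> N z != 0.
Proof. by move=> -[_ y0]; exact: enorm_neq0. Qed.

Lemma smooth_in_enorm2 : smooth_in (slit Omega) (fun z => N z).
Proof.
apply: smooth_in_sqrt open_slit (smooth_in_yy open_slit) _.
by move=> z [_]; rewrite dotp_gt0.
Qed.

Lemma smooth_in_rs2 : smooth_in (slit Omega) (fun z => (rs_of z).2).
Proof.
apply: smooth_inM open_slit (smooth_in_xy open_slit) _.
exact: smooth_inV open_slit smooth_in_enorm2 N0.
Qed.

Lemma smooth_in_rs (f : R * R -> R) : smooth_in U f ->
  smooth_in (slit Omega) (fun z => f (rs_of z)).
Proof.
move=> sf; apply: (smooth_in_comp2 open_slit oU sf _ smooth_in_rs2) => //.
apply: (smooth_in_eq open_slit _ (smooth_in_xx open_slit)) => z _.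
by rewrite enorm_sqr.
Qed.

Let sp1 : smooth_in U p1. Proof. exact: smooth_in_der_r. Qed.
Let sp2 : smooth_in U p2. Proof. exact: smooth_in_der_s. Qed.

Let dU (f : R * R -> R) z : smooth_in U f -> slit Omega z -> differentiable f (rs_of z).
Proof. by move=> sf /U_rs; exact: smooth_in_diff. Qed.

Lemma smooth_flatPx k : smooth_in (slit Omega) (flatPx k).
Proof.
have oS := open_slit; apply: smooth_inD => //; apply: smooth_inM => //.
- apply: smooth_inM => //; last exact: smooth_in_coord1.
  by apply: smooth_inM => //; [exact: smooth_in_cst | exact: smooth_in_enorm2].
- exact: (smooth_in_rs sp1).
- exact: smooth_in_coord2.
- exact: (smooth_in_rs sp2).
Qed.

Lemma smooth_flatPy k : smooth_in (slit Omega) (flatPy k).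
Proof.
have oS := open_slit; have sV := smooth_inV oS smooth_in_enorm2 N0.
have sy := @smooth_in_coord2 R n (slit Omega) k.
apply: smooth_inD => //; apply: smooth_inM => //.
- by apply: smooth_inM => //; exact: (smooth_in_rs sp).
- exact: (smooth_in_rs sp2).
- apply: smooth_inB => //; first exact: smooth_in_coord1.
  by apply: smooth_inM => //; apply: smooth_inM => //; exact: smooth_in_rs2.
Qed.

Lemma is_derive_flatP_x k z : slit Omega z -> is_derive z (ex k) flatP (flatPx k z).
Proof.
move=> sz; have y0 : z.2 != 0 by case: sz.
apply: is_derive_eq; first apply: is_derive_mul.
- exact: is_derive_enorm2.
- apply: is_derive_rs => //; exact: dU.
- rewrite /flatPx /= !dotp0l !dotp_deltal; move: (N0 sz).
  move: (enorm z.2) (dotp z.1 z.2) (z.1 0 k) (z.2 0 k) => N c x y.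
  move: (p (rs_of z)) (p1 (rs_of z)) (p2 (rs_of z)) (p12 (rs_of z)) (p22 (rs_of z)).
  move: (der_r p1 (rs_of z)) (der_r p2 (rs_of z)) => *.
  by field.
Qed.

Lemma is_derive_flatP_y k z : slit Omega z -> is_derive z (ey k) flatP (flatPy k z).
Proof.
move=> sz; have y0 : z.2 != 0 by case: sz.
apply: is_derive_eq; first apply: is_derive_mul.
- exact: is_derive_enorm2.
- apply: is_derive_rs => //; exact: dU.
- rewrite /flatPy /= !dotp0l !dotp_deltal; move: (N0 sz).
  move: (enorm z.2) (dotp z.1 z.2) (z.1 0 k) (z.2 0 k) => N c x y.
  move: (p (rs_of z)) (p1 (rs_of z)) (p2 (rs_of z)) (p12 (rs_of z)) (p22 (rs_of z)).
  move: (der_r p1 (rs_of z)) (der_r p2 (rs_of z)) => *.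
  by field.
Qed.

Lemma is_derive_flatQ_y k z : slit Omega z -> is_derive z (ey k) flatQ (flatQy k z).
Proof.
move=> sz; have y0 : z.2 != 0 by case: sz.
have -> : flatQ = fun z => (N z * N z) *
    (2 * (rs_of z).2 * p1 (rs_of z) + p2 (rs_of z)) by apply/funext => ?; rewrite -expr2.
apply: is_derive_eq; first apply: is_derive_mul.
- by apply: is_derive_mul; exact: is_derive_enorm2.
- apply: is_derive_add; last by apply: (is_derive_rs (f := p2)) => //; exact: dU.
  apply: is_derive_mul; last by apply: (is_derive_rs (f := p1)) => //; exact: dU.
  by apply: is_derive_mul; exact: is_derive_rs2.
- rewrite /flatQy /= !dotp0l !dotp_deltal; move: (N0 sz).
  move: (enorm z.2) (dotp z.1 z.2) (z.1 0 k) (z.2 0 k) => N c x y.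
  move: (p (rs_of z)) (p1 (rs_of z)) (p2 (rs_of z)) (p12 (rs_of z)) (p22 (rs_of z)).
  move: (der_r p1 (rs_of z)) (der_r p2 (rs_of z)) => *.
  by field.
Qed.

Lemma flatQ_sum z : slit Omega z -> \sum_j flatPx j z * z.2 0 j = flatQ z.
Proof.
move=> sz; have xyE : dotp z.1 z.2 = (rs_of z).2 * N z by rewrite divfK ?N0.
transitivity (2 * N z * p1 (rs_of z) * dotp z.1 z.2 + p2 (rs_of z) * dotp z.2 z.2).
  rewrite /flatPx /dotp !mulr_sumr -big_split; apply: eq_bigr => j _.
  move: (p1 (rs_of z)) (p2 (rs_of z)) (z.1 0 j) (z.2 0 j) (enorm z.2) => *.
  by rewrite /=; ring.
rewrite -enorm_sqr /flatQ xyE.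
by move: (p1 (rs_of z)) (p2 (rs_of z)) (rs_of z).2 (enorm z.2) => *; ring.
Qed.

(** The vector multiplying [p2] in [flatPy] is orthogonal to [y], so only the term in [p] survives
    the contraction. *)
Lemma flatP_euler z : slit Omega z -> \sum_j flatPy j z * z.2 0 j = flatP z.
Proof.
move=> sz; have xyE : dotp z.1 z.2 = (rs_of z).2 * N z by rewrite divfK ?N0.
transitivity ((p (rs_of z) - p2 (rs_of z) * (rs_of z).2) / N z * dotp z.2 z.2
     + p2 (rs_of z) * dotp z.1 z.2).
  rewrite /flatPy /dotp !mulr_sumr -big_split; apply: eq_bigr => j _.
  move: (p (rs_of z)) (p2 (rs_of z)) (rs_of z).2 (z.1 0 j) (z.2 0 j) (N0 sz).
  by move: (enorm z.2) => N a b s x y hN /=; field.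
rewrite -enorm_sqr /flatP xyE; move: (N0 sz).
by move: (p (rs_of z)) (p2 (rs_of z)) (rs_of z).2 (enorm z.2) => a b s N hN; field.
Qed.

Let near_slit (f g : V * V -> R) z : (forall z, slit Omega z -> f z = g z) ->
  slit Omega z -> \forall y \near z, f y = g y.
Proof. exact: open_near_eq open_slit. Qed.

(** Obtained by differentiating [flatQ_sum] in [y^k]; the subtracted term comes from the derivative
    of the factor [y^j]. The second derivatives of [flatP] are thus never computed. *)
Lemma flatQy_sum k z : slit Omega z ->
  \sum_j 'D_(ey k) (flatPx j) z * z.2 0 j = flatQy k z - flatPx k z.
Proof.
move=> sz; apply/eqP; rewrite eq_sym subr_eq; apply/eqP.
rewrite -[LHS](derive_val (is_derive := is_derive_flatQ_y k sz)).
rewrite -(near_eq_derive _ (near_slit flatQ_sum sz)).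
apply: derive_val; apply: is_derive_eq.
  apply: is_derive_bigsum => j; apply: is_derive_mul (is_derive_coord2 _ _ _).
  exact: is_derive_diff (smooth_in_diff (smooth_flatPx j) sz).
rewrite big_split/=; congr (_ + _).
rewrite (bigD1 k)//= big1 ?addr0 => [|j jk].
  by rewrite mxE !eqxx mulr1.
by rewrite mxE (negbTE jk) andbF mulr0.
Qed.

(** The derivative of [flatP_euler] in [y^k], where [flatPy k] occurs on both sides and cancels. *)
Lemma flatPyy_sum k z : slit Omega z -> \sum_j 'D_(ey k) (flatPy j) z * z.2 0 j = 0.
Proof.
move=> sz; apply: (addIr (flatPy k z)); rewrite add0r.
rewrite -[RHS](derive_val (is_derive := is_derive_flatP_y k sz)).
rewrite -(near_eq_derive _ (near_slit flatP_euler sz)).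
apply/esym/derive_val; apply: is_derive_eq.
  apply: is_derive_bigsum => j; apply: is_derive_mul (is_derive_coord2 _ _ _).
  exact: is_derive_diff (smooth_in_diff (smooth_flatPy j) sz).
rewrite big_split/=; congr (_ + _).
rewrite (bigD1 k)//= big1 ?addr0 => [|j jk].
  by rewrite mxE !eqxx mulr1.
by rewrite mxE (negbTE jk) andbF mulr0.
Qed.

Lemma spray_coefE i z : spray_coef p i z = flatP z * z.2 0 i.
Proof. by []. Qed.

Lemma dx_flat i k z : slit Omega z -> dx k (G i) z = flatPx k z * z.2 0 i.
Proof.
move=> sz; rewrite /dx (near_eq_derive _ (near_slit (GE i) sz)).
apply: derive_val; apply: is_derive_eq.
  exact: is_derive_mul (is_derive_flatP_x k sz) (is_derive_coord2 _ _ _).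
by rewrite /= mxE mulr0 addr0.
Qed.

Lemma dy_flat i k z : slit Omega z ->
  dy k (G i) z = flatPy k z * z.2 0 i + flatP z * (i == k)%:R.
Proof.
move=> sz; rewrite /dy (near_eq_derive _ (near_slit (GE i) sz)).
apply: derive_val; apply: is_derive_eq.
  exact: is_derive_mul (is_derive_flatP_y k sz) (is_derive_coord2 _ _ _).
by rewrite /= mxE eqxx.
Qed.

Lemma dydx_flat i j k z : slit Omega z ->
  dy k (dx j (G i)) z
  = 'D_(ey k) (flatPx j) z * z.2 0 i + flatPx j z * (i == k)%:R.
Proof.
move=> sz; rewrite /dy (near_eq_derive _ (near_slit (dx_flat i j) sz)).
apply: derive_val; apply: is_derive_eq.
  apply: is_derive_mul _ (is_derive_coord2 _ _ _).
  exact: is_derive_diff (smooth_in_diff (smooth_flatPx j) sz).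
by rewrite /= mxE eqxx.
Qed.

Lemma dydy_flat i j k z : slit Omega z ->
  dy k (dy j (G i)) z
  = 'D_(ey k) (flatPy j) z * z.2 0 i + flatPy j z * (i == k)%:R
    + flatPy k z * (i == j)%:R.
Proof.
move=> sz; rewrite [in LHS]/dy (near_eq_derive _ (near_slit (dy_flat i j) sz)).
apply: derive_val; apply: is_derive_eq.
  apply: is_derive_add.
    apply: is_derive_mul _ (is_derive_coord2 _ _ _).
    exact: is_derive_diff (smooth_in_diff (smooth_flatPy j) sz).
  exact: is_derive_mul (is_derive_flatP_y k sz) (is_derive_cst _ _ _).
by rewrite /= mxE eqxx mulr0 addr0.
Qed.

Let sum_deltar (f : 'I_n -> R) k : \sum_j f j * (j == k)%:R = f k.
Proof.
rewrite (bigD1 k)//= eqxx mulr1 big1 ?addr0// => j jk.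
by rewrite (negbTE jk) mulr0.
Qed.

Let sum_deltal (f : 'I_n -> R) i : \sum_j f j * (i == j)%:R = f i.
Proof.
by rewrite -[RHS]sum_deltar; apply: eq_bigr => j _; rewrite eq_sym.
Qed.

(** Every second derivative occurs contracted with [y], so [flatQy_sum] and [flatPyy_sum] eliminate
    it; the remaining sums collapse by [flatP_euler] or against a Kronecker symbol. *)
Lemma Riemann_flat i k z : slit Omega z ->
  Riemann G i k z = (flatP z ^+ 2 - flatQ z) * (i == k)%:R
    - (flatP z * flatPy k z + flatQy k z - 3 * flatPx k z) * z.2 0 i.
Proof.
move=> sz; rewrite /Riemann dx_flat//.
set d := (i == k)%:R; set y := z.2 0.
have -> : \sum_j dy k (dx j (G i)) z * y j
    = (flatQy k z - flatPx k z) * y i + flatQ z * d.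
  rewrite -flatQy_sum// -flatQ_sum// !mulr_suml -big_split/=.
  apply: eq_bigr => j _; rewrite dydx_flat// -/d -/(y i) -/(y j).
  by move: ('D_(_) _ z) (flatPx j z) (y i) (y j) d => *; ring.
have -> : \sum_j G j z * dy k (dy j (G i)) z
    = flatP z * (flatP z * d + flatPy k z * y i).
  transitivity (\sum_j (flatP z * y i * ('D_(ey k) (flatPy j) z * y j)
     + flatP z * d * (flatPy j z * y j) + (flatP z * flatPy k z * y j) * (i == j)%:R)).
    apply: eq_bigr => j _; rewrite GE// dydy_flat// spray_coefE -/d -/(y i) -/(y j).
    move: ('D_(_) _ z) (flatPy j z) (flatPy k z) (flatP z) (y i) (y j) d.
    by move: ((i == j)%:R : R) => *; ring.
  rewrite !big_split/= -!mulr_sumr flatPyy_sum// flatP_euler// sum_deltal.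
  by move: (flatP z) (flatPy k z) (y i) d => *; ring.
have -> : \sum_j dy j (G i) z * dy k (G j) z
    = 3 * flatP z * flatPy k z * y i + flatP z ^+ 2 * d.
  transitivity (\sum_j (flatPy k z * y i * (flatPy j z * y j)
     + (flatP z * flatPy j z * y i) * (j == k)%:R
     + (flatP z * flatPy k z * y j) * (i == j)%:R
     + (flatP z ^+ 2 * (j == k)%:R) * (i == j)%:R)).
    apply: eq_bigr => j _; rewrite !dy_flat// -/(y i) -/(y j).
    move: ((i == j)%:R : R) ((j == k)%:R : R).
    by move: (flatPy j z) (flatPy k z) (flatP z) (y i) (y j) => *; ring.
  rewrite !big_split/= -!mulr_sumr flatP_euler// sum_deltar !sum_deltal -/d.
  by move: (flatP z) (flatPy k z) (y i) d => *; ring.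
rewrite -/(y i).
by move: (flatP z) (flatPy k z) (flatQ z) (flatQy k z) (flatPx k z) (y i) d => *; ring.
Qed.

Hypothesis hn : (2 <= n)%N.

(** The right-hand side has rank at most one, while a nonzero multiple of the identity has rank
    [n >= 2]. Consequently the curvature determines both [S] and [tau]. *)
Lemma scalar_rank1 (y : V) (a : R) (b : 'I_n -> R) : y != 0 ->
  (forall i k, a * (i == k)%:R = b k * y 0 i) -> a = 0 /\ forall k, b k = 0.
Proof.
move=> y0 H; have [i yi] : exists i, y 0 i != 0.
  apply/existsP; apply: contraR y0; rewrite negb_exists => /forallP y0.
  by apply/eqP/rowP => i; rewrite mxE; apply/eqP; have := y0 i; rewrite negbK.
have [k ki] : exists k : 'I_n, i != k.
  have [i0|i0] := eqVneq i (Ordinal (ltnW hn)); last by exists (Ordinal (ltnW hn)).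
  by exists (Ordinal hn); rewrite i0.
have bk : b k = 0.
  have /eqP := H i k; rewrite (negbTE ki) mulr0 eq_sym mulf_eq0 (negbTE yi) orbF.
  by move/eqP.
have a0 : a = 0 by have := H k k; rewrite eqxx bk mulr1 mul0r.
split=> // k'; have /eqP := H i k'.
by rewrite a0 mul0r eq_sym mulf_eq0 (negbTE yi) orbF => /eqP.
Qed.

(** Euler's identity again, [flatQ] being homogeneous of degree two in [y]. *)
Lemma sum_flatQy z : slit Omega z -> \sum_k flatQy k z * z.2 0 k = 2 * flatQ z.
Proof.
move=> sz; have xyE : dotp z.1 z.2 = (rs_of z).2 * N z by rewrite divfK ?N0.
rewrite /flatQy /flatQ.
set c := 2 * (rs_of z).2 * p1 (rs_of z) + p2 (rs_of z).
set d := 2 * p1 (rs_of z) + 2 * (rs_of z).2 * p12 (rs_of z) + p22 (rs_of z).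
transitivity ((2 * c - d * (rs_of z).2) * dotp z.2 z.2 + N z * d * dotp z.1 z.2).
  rewrite /dotp !mulr_sumr -big_split; apply: eq_bigr => j _.
  move: c d (rs_of z).2 (z.1 0 j) (z.2 0 j) (N0 sz).
  by move: (enorm z.2) => N c d s x y hN /=; field.
rewrite -enorm_sqr xyE.
by move: c d (rs_of z).2 (enorm z.2) => c d s N; ring.
Qed.

(** By [scalar_rank1], [S] is [P^2 - Q] and [tau k] is the coefficient in [Riemann_flat]. Half the
    derivative of [S] is [P P_(y^k) - Q_(y^k) / 2], and equating it with [tau k] leaves
    [3/2 Q_(y^k) = 3 P_(x^k)]. *)
Lemma isotropic_flat :
  isotropic_curvature Omega G <-> forall k z, slit Omega z -> flatQy k z = 2 * flatPx k z.
Proof.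
have dXi k z : slit Omega z -> dy k (fun z => flatP z ^+ 2 - flatQ z) z =
    2 * flatP z * flatPy k z - flatQy k z.
  move=> sz; apply: derive_val; apply: is_derive_eq.
    apply: is_derive_sub (is_derive_flatQ_y k sz).
    exact: is_derive_mul (is_derive_flatP_y k sz) (is_derive_flatP_y k sz).
  by ring.
split=> [[S [tau [H T]]] k z sz|H].
  have E y : slit Omega y -> S y = flatP y ^+ 2 - flatQ y /\
      forall k, tau k y = flatP y * flatPy k y + flatQy k y - 3 * flatPx k y.
    move=> sy; have [HR _] := H y sy; have y0 : y.2 != 0 by case: sy.
    have [|a0 b0] := @scalar_rank1 y.2 (S y - (flatP y ^+ 2 - flatQ y))
      (fun k => tau k y - (flatP y * flatPy k y + flatQy k y - 3 * flatPx k y)) y0.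
      by move=> i j; have := HR i j; rewrite Riemann_flat//; lra.
    by split=> [|j]; apply/eqP; rewrite -subr_eq0; apply/eqP.
  have [_ Ek] := E z sz; have := T k z sz; rewrite Ek.
  rewrite /dy (near_eq_derive _ (near_slit (fun y sy => (E y sy).1) sz)).
  by rewrite -/(dy k _ z) dXi//; lra.
exists (fun z => flatP z ^+ 2 - flatQ z).
exists (fun k z => flatP z * flatPy k z + flatQy k z - 3 * flatPx k z).
split=> [z sz|k z sz]; last by rewrite dXi// H//; lra.
split=> [i k|]; first exact: Riemann_flat.
transitivity (\sum_k (flatP z * (flatPy k z * z.2 0 k) + flatQy k z * z.2 0 k
    - 3 * (flatPx k z * z.2 0 k))); last by apply: eq_bigr => k _; ring.
rewrite sumrB big_split/= -!mulr_sumr flatP_euler// sum_flatQy// flatQ_sum//.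
by ring.
Qed.

(** Since [slit Omega] is open, [P^2 = Q] may be differentiated there: [Q_(y^k) = 2 P P_(y^k)]. The
    coefficient of [y^i] in the curvature then becomes [3 (P P_(y^k) - P_(x^k))]. *)
Lemma zero_flat : zero_curvature Omega G <-> forall z, slit Omega z ->
  flatP z ^+ 2 = flatQ z /\ forall k, flatPx k z = flatP z * flatPy k z.
Proof.
have H z : (forall z, slit Omega z -> flatP z ^+ 2 = flatQ z) -> slit Omega z ->
    forall k, flatQy k z = 2 * flatP z * flatPy k z.
  move=> E sz k; rewrite -[LHS](derive_val (is_derive := is_derive_flatQ_y k sz)).
  rewrite -(near_eq_derive _ (near_slit E sz)); apply: derive_val.
  apply: is_derive_eq.
    exact: is_derive_mul (is_derive_flatP_y k sz) (is_derive_flatP_y k sz).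
  by ring.
split=> [Z|E i k z sz].
  have E z : slit Omega z -> flatP z ^+ 2 = flatQ z /\ forall k,
      flatP z * flatPy k z + flatQy k z - 3 * flatPx k z = 0.
    move=> sz; have y0 : z.2 != 0 by case: sz.
    have [|a0 b0] := @scalar_rank1 z.2 (flatP z ^+ 2 - flatQ z)
      (fun k => flatP z * flatPy k z + flatQy k z - 3 * flatPx k z) y0.
      by move=> i k; have := Z i k z sz; rewrite Riemann_flat//; lra.
    by split=> //; apply/eqP; rewrite -subr_eq0; apply/eqP.
  move=> z sz; have [EQ Ek] := E z sz; split=> // k.
  by have := Ek k; rewrite (H z (fun y sy => (E y sy).1) sz); lra.
have [EQ Ek] := E z sz.
rewrite Riemann_flat// EQ (H z (fun y sy => (E y sy).1) sz) Ek; ring.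
Qed.

End FlatCurvature.

(** * The domain of the profile *)

Section RadialDomain.
Context {R : realType}.

(* The set [B] of the values of [r] below the squared radius of the ball. *)
Definition radial n (Omega : set 'rV[R]_n) (B : set R) : Prop :=
  [/\ open B, (forall s t, B t -> s <= t -> B s), B 0 &
      forall x, Omega x <-> B (enorm x ^+ 2)].

Lemma radialT n : radial [set: 'rV[R]_n] setT.
Proof. by split=> //; exact: openT. Qed.

Lemma radial_eball n (rho : R) : 0 < rho -> radial (eball n rho) [set t | t < rho ^+ 2].
Proof.
move=> rho0; split=> [|s t /= + st| |x] /=.
- exact: open_lt.
- exact: le_lt_trans.
- by rewrite exprn_gt0.
- by rewrite ltr_pXn2r// nnegrE ?sqrtr_ge0// ltW.
Qed.

Lemma radial_exists n (Omega : set 'rV[R]_n) :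
  Omega = setT \/ (exists rho : R, 0 < rho /\ Omega = eball n rho) ->
  exists B, radial Omega B.
Proof.
case=> [->|[rho [rho0 ->]]]; first by exists setT; exact: radialT.
by eexists; exact: radial_eball.
Qed.

Variables (n : nat) (Omega : set 'rV[R]_n) (B : set R).
Hypotheses (hn : (2 <= n)%N) (rB : radial Omega B).

Local Notation i0 := (Ordinal (ltnW hn) : 'I_n).
Local Notation i1 := (Ordinal hn : 'I_n).

Lemma radial_open : open Omega.
Proof.
have [oB _ _ OB] := rB.
have -> : Omega = (fun x => dotp x x) @^-1` B.
  by apply/seteqP; split=> x /=; rewrite -enorm_sqr => /OB.
have sc (i : 'I_n) : smooth_in setT (fun x : 'rV[R]_n => x 0 i).
  by apply: smooth_in_lin; [exact: coord_linear | exact: coord_cont].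
have sd : smooth_in setT (fun x : 'rV[R]_n => \sum_(i < n) x 0 i * x 0 i).
  by apply: (smooth_in_sum _ openT) => i; exact: (smooth_inM openT).
by apply: open_comp => // x _; exact: (smooth_in_continuous sd).
Qed.

Let e01 a b : 'rV[R]_n := \row_i (a * (i == i0)%:R + b * (i == i1)%:R).

Let e01_0 a b : e01 a b 0 i0 = a.
Proof. by rewrite mxE eqxx mulr1 mulr0 addr0. Qed.

Let e01_1 a b : e01 a b 0 i1 = b.
Proof. by rewrite mxE eqxx mulr1 mulr0 add0r. Qed.

Let dotp_e01 a b c d : dotp (e01 a b) (e01 c d) = a * c + b * d.
Proof.
rewrite /dotp (bigD1 i0)//= (bigD1 i1)//= !e01_0 !e01_1 big1 ?addr0// => i.
by case/andP=> ni0 ni1; rewrite !mxE (negbTE ni0) (negbTE ni1) !mulr0 addr0 mul0r.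
Qed.

(** In the plane of the first two coordinates, [x] lies on the first axis and [y] is the unit vector
    whose angle with it has cosine [s / sqrt r]. The coordinates are exposed because the equations
    for [p] are read off from them. For [r = 0] the convention [0^-1 = 0] makes [y] the second basis
    vector. *)
Lemma rs_witness (r s : R) : s ^+ 2 <= r -> B r ->
  exists z, [/\ slit Omega z, rs_of z = (r, s), enorm z.2 = 1 &
    [/\ z.1 0 i0 = Num.sqrt r, z.1 0 i1 = 0, z.2 0 i0 = s / Num.sqrt r
       & z.2 0 i1 = Num.sqrt (1 - s ^+ 2 / r)]].
Proof.
move=> sr Br; have [_ _ _ OB] := rB.
have r0 : 0 <= r by apply: le_trans sr; exact: sqr_ge0.
have sE : Num.sqrt r * (s / Num.sqrt r) = s.
  have [r00|r00] := eqVneq r 0; last by rewrite mulrC divfK// sqrtr_eq0 -ltNge lt_def r00.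
  have s0 : s = 0.
    by apply/eqP; rewrite -sqrf_eq0 eq_le sqr_ge0 andbT (le_trans sr)// r00.
  by rewrite s0 mul0r mulr0.
have q0 : 0 <= 1 - s ^+ 2 / r.
  have [->|r00] := eqVneq r 0; first by rewrite invr0 mulr0 subr0.
  by rewrite subr_ge0 ler_pdivrMr ?mul1r// lt_def r00.
have y1 : enorm (e01 (s / Num.sqrt r) (Num.sqrt (1 - s ^+ 2 / r))) = 1.
  rewrite /enorm dotp_e01 -!expr2 sqr_sqrtr// exprMn exprVn sqr_sqrtr//.
  by rewrite addrC subrK sqrtr1.
have xx : enorm (e01 (Num.sqrt r) 0) ^+ 2 = r.
  by rewrite enorm_sqr dotp_e01 mulr0 addr0 -expr2 sqr_sqrtr.
exists (e01 (Num.sqrt r) 0, e01 (s / Num.sqrt r) (Num.sqrt (1 - s ^+ 2 / r))).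
split=> //=.
- split=> /=; first by apply/OB; rewrite xx.
  by rewrite -enorm_gt0 y1.
- by rewrite /rs_of /= xx y1 divr1 dotp_e01 mul0r addr0 sE.
Qed.

Lemma rs_domE (r s : R) : rs_dom Omega (r, s) <-> s ^+ 2 <= r /\ B r.
Proof.
have [_ _ _ OB] := rB; split=> [[z [Oz y0] [<- <-]]|[sr Br]].
  split; last exact/OB.
  rewrite exprMn exprVn !enorm_sqr ler_pdivrMr ?dotp_gt0//.
  exact: dotp_sqr_le.
by have [z [sz zE _ _]] := rs_witness sr Br; exists z.
Qed.

Lemma r_domE (t : R) : r_dom Omega t <-> 0 <= t /\ B t.
Proof.
have [_ _ _ OB] := rB; split=> [[x Ox <-]|[t0 Bt]].
  by split; [exact: sqr_ge0 | exact/OB].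
have [|z [[Oz _] [zE _] _ _]] := @rs_witness t 0 _ Bt; first by rewrite expr0n.
by exists z.1.
Qed.

(** Transfers an equation from the points with [s != 0] and [s^2 < r], where it can be derived, to
    the whole domain. *)
Lemma rs_dom_dense (F : R * R -> R) :
  (forall r s : R, s ^+ 2 <= r -> B r -> {for (r, s), continuous F}) ->
  (forall r s : R, s != 0 -> s ^+ 2 < r -> B r -> F (r, s) = 0) ->
  forall r s : R, s ^+ 2 <= r -> B r -> F (r, s) = 0.
Proof.
move=> cF F0 r s sr Br; have [oB _ _ _] := rB.
(* The point is approached along [(r + a e, s + b e)] with [e] decreasing to [0]. The sign [b] moves
   [s] away from [0], and [a] makes [r] grow faster than [s^2], whose increment is [2 |s| e + e^2],
   less than [a e] for [e < 1]. *)
pose a : R := 2 * `|s| + 1; pose b : R := if 0 <= s then 1 else -1.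
have bs : b * s = `|s|.
  rewrite /b; case: ifPn => [s0|]; first by rewrite ger0_norm ?mul1r.
  by rewrite -ltNge => s0; rewrite ltr0_norm// mulN1r.
have b2 : b ^+ 2 = 1 by rewrite /b; case: ifP; rewrite ?sqrrN expr1n.
pose g (e : R) : R * R := (r + a * e, s + b * e).
have cl c d : (fun e : R => c + d * e) @ (0 : R) --> (c : R).
  rewrite -{2}[c]addr0 -{2}(mulr0 d); apply: cvgD; first exact: cvg_cst.
  by apply: cvgM; [exact: cvg_cst | exact: cvg_id].
have cg : g @ (0 : R) --> (r, s).
  by apply: (@cvg_pair _ _ _ _ (nbhs r) (nbhs s)); exact: cl.
have Bg : \forall e \near (0 : R)^'+, B (r + a * e).
  have cr : (r + a * e) @[e --> (0 : R)^'+] --> (r : R).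
    by apply: cvg_at_right_filter; exact: cl.
  exact: (cr B (open_nbhs_nbhs (conj oB Br))).
have cFg : F (g e) @[e --> (0 : R)^'+] --> F (r, s).
  apply: cvg_at_right_filter; apply: (@cvg_comp _ _ _ g F _ (nbhs (r, s))) => //.
  exact: cF.
have c0 : F (g e) @[e --> (0 : R)^'+] --> (0 : R).
  apply: (@cvg_trans _ ((fun=> (0 : R)) @ (0 : R)^'+)); last exact: cvg_cst.
  apply: near_eq_cvg; near=> e.
  have e0 : 0 < e by near: e; exact: nbhs_right_gt.
  have e1 : e < 1 by near: e; exact: nbhs_right_lt.
  rewrite /g F0//.
  - apply/eqP => E; have : b * (s + b * e) = 0 by rewrite E mulr0.
    rewrite mulrDr mulrA -expr2 b2 bs mul1r.
    by have := normr_ge0 s; lra.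
  - have -> : (s + b * e) ^+ 2 = s ^+ 2 + 2 * (b * s) * e + b ^+ 2 * e ^+ 2 by ring.
    rewrite b2 bs /a mul1r.
    have : e ^+ 2 < e by rewrite expr2 gtr_pMl.
    by lra.
  - by near: e.
exact: (@cvg_unique _ _ _ _ _ _ cFg c0).
Unshelve. all: by end_near. Qed.

End RadialDomain.

(** * Curvature in terms of the profile *)

Section Profile.
Context {R : realType}.
Variables (n : nat) (Omega : set 'rV[R]_n) (B : set R).
Hypotheses (hn : (2 <= n)%N) (rB : radial Omega B).
Variables (p : R * R -> R) (U : set (R * R)).
Hypotheses (oU : open U) (DU : rs_dom Omega `<=` U) (sp : smooth_in U p).

Local Notation p1 := (der_r p).
Local Notation p2 := (der_s p).
Local Notation p12 := (der_s p1).
Local Notation p22 := (der_s p2).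

Let sp1 : smooth_in U p1. Proof. exact: smooth_in_der_r. Qed.
Let sp2 : smooth_in U p2. Proof. exact: smooth_in_der_s. Qed.
Let sp12 : smooth_in U p12. Proof. exact: smooth_in_der_s. Qed.
Let sp22 : smooth_in U p22. Proof. exact: smooth_in_der_s. Qed.

Let DB (r s : R) : s ^+ 2 <= r -> B r -> U (r, s).
Proof. by move=> sr Br; apply/DU/(rs_domE hn rB). Qed.

(* Isotropy of the curvature amounts to the vanishing of this expression. *)
Definition isoE (z : R * R) : R := 2 * z.2 * p12 z + p22 z - 2 * p1 z.

Lemma smooth_isoE : smooth_in U isoE.
Proof.
apply: smooth_inB => //.
  apply: smooth_inD => //; apply: smooth_inM => //; apply: smooth_inM => //.
    exact: smooth_in_cst.
  exact: smooth_in_s.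
by apply: smooth_inM => //; exact: smooth_in_cst.
Qed.

(* The curves [r - s ^+ 2 = t] are the characteristics of [isoE = 0]. *)
Lemma is_derive_characteristic t s : U (t + s ^+ 2, s) ->
  is_derive s 1 (fun s => p (t + s ^+ 2, s) - s * p2 (t + s ^+ 2, s))
    (- (s * isoE (t + s ^+ 2, s))).
Proof.
move=> Us; have Dr : is_derive s (1 : R) (fun s : R => t + s ^+ 2) (2 * s).
  refine (is_derive_eq (is_derive_add (is_derive_cst t _ _)
    (is_deriveX 2 (is_derive_id _ _))) _).
  by rewrite add0r expr1 [_ *: _]mulr1.
apply: is_derive_eq.
  apply: is_derive_sub.
    apply: (is_derive_partials _ Dr (is_derive_id _ _)); exact: smooth_in_diff Us.
  apply: is_derive_mul (is_derive_id _ _) _.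
  apply: (is_derive_partials (p := p2) _ Dr (is_derive_id _ _)).
  exact: (smooth_in_diff sp2) Us.
rewrite (der_rs_comm oU sp Us) /isoE/=; ring.
Qed.

Lemma is_derive_quotient r s : U (r, s) -> s != 0 ->
  is_derive s 1 (fun s => p (r, s) / s) (- (p (r, s) - s * p2 (r, s)) / s ^+ 2).
Proof.
move=> Us s0; apply: is_derive_eq.
  apply: is_derive_mul; last by apply: is_derive_inv => //; exact: is_derive_id.
  apply: (is_derive_partials _ (is_derive_cst _ _ _) (is_derive_id _ _)).
  exact: smooth_in_diff Us.
by rewrite mul0r add0r mul1r; field.
Qed.

(** The characteristic through [(r, s)] is followed down to [s = 0]. It stays in the domain because
    [r] decreases along it and [B] is closed downwards. *)
Lemma isoE_characteristic :
  (forall r s : R, s ^+ 2 <= r -> B r -> isoE (r, s) = 0) ->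
  forall r s : R, s ^+ 2 <= r -> B r -> p (r, s) - s * p2 (r, s) = p (r - s ^+ 2, 0).
Proof.
move=> E0 r s sr Br; have [_ dB _ _] := rB.
have [t0 tr] : 0 <= r - s ^+ 2 /\ r = r - s ^+ 2 + s ^+ 2.
  by rewrite subr_ge0 subrK.
set t := r - s ^+ 2 in t0 tr *; rewrite tr.
suff D0 (x : R) : `|x| <= `|s| ->
    is_derive x (1 : R) (fun s => p (t + s ^+ 2, s) - s * p2 (t + s ^+ 2, s)) 0.
  by rewrite (derive0_cst_cc D0) expr0n mul0r subr0 addr0.
move=> xs; have x2 : x ^+ 2 <= s ^+ 2.
  by rewrite -[x ^+ 2]real_normK ?num_real// -[s ^+ 2]real_normK ?num_real// lerXn2r ?nnegrE.
have Bx : B (t + x ^+ 2) by apply: (dB _ _ Br); rewrite tr lerD2l.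
have tx : x ^+ 2 <= t + x ^+ 2 by rewrite lerDr.
by apply: is_derive_eq (is_derive_characteristic (DB tx Bx)) _; rewrite E0// mulr0 oppr0.
Qed.

(** The antiderivative is [p / s] itself: the function [v] is absorbed into the constant of
    integration, and [p] is its own smooth extension across [s = 0]. *)
Lemma integral_form_profile (u : R -> R) :
  (forall r s : R, s ^+ 2 <= r -> B r -> s != 0 ->
     p (r, s) - s * p2 (r, s) = - u (r - s ^+ 2)) ->
  integral_form Omega u (fun=> 0) p.
Proof.
move=> wu; exists (fun r s => p (r, s) / s); split; last first.
  by move=> r s _ s0; rewrite addr0 divfK.
split=> [r s /(rs_domE hn rB)[sr Br] s0|].
  by apply: is_derive_eq (is_derive_quotient (DB sr Br) s0) _; rewrite wu// opprK.
exists p; split; first by exists U.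
by move=> r s _ s0; rewrite divfK.
Qed.

(** The strict inequality leaves room to vary [s] at fixed [r], so [A r] can be differentiated as
    [p / s - v r]. *)
Lemma profile_integral_form (u v : R -> R) : integral_form Omega u v p ->
  forall r s : R, s != 0 -> s ^+ 2 < r -> B r ->
  p (r, s) - s * p2 (r, s) = - u (r - s ^+ 2).
Proof.
move=> [A [[DA _] pA]] r s s0 sr Br.
have dom : rs_dom Omega (r, s) by apply/(rs_domE hn rB); split=> //; exact: ltW.
have nA : \forall x \near s, A r x = p (r, x) / x - v r.
  near=> x; have x0 : x != 0.
    by near: x; apply: open_nbhs_nbhs; split=> //; exact: open_neq.
  rewrite pA// ?mulfK ?addrK//; apply/(rs_domE hn rB); split=> //; apply: ltW.
  near: x; have : (x ^+ 2) @[x --> s] --> s ^+ 2 by exact: exprn_continuous.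
  by move/(_ [set y | y < r]); apply; apply: open_nbhs_nbhs; split=> //; exact: open_lt.
have := derive_val (is_derive := DA r s dom s0).
rewrite (near_eq_derive _ nA).
have Dq := is_derive_sub (is_derive_quotient (DU dom) s0) (is_derive_cst (v r) _ _).
rewrite (derive_val (is_derive := Dq)) subr0 => E.
have s20 : s ^+ 2 != 0 by rewrite sqrf_eq0.
by apply: oppr_inj; apply: (mulIf (invr_neq0 s20)); rewrite opprK.
Unshelve. all: by end_near. Qed.

(** Here [p - s p_s] is constant along each characteristic near [s], so its derivative [- s isoE]
    vanishes. Dividing by [s] requires [s != 0], and [rs_dom_dense] recovers the other points. *)
Lemma isoE_profile (u : R -> R) :
  (forall r s : R, s != 0 -> s ^+ 2 < r -> B r ->
     p (r, s) - s * p2 (r, s) = - u (r - s ^+ 2)) ->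
  forall r s : R, s ^+ 2 <= r -> B r -> isoE (r, s) = 0.
Proof.
move=> wu; apply: (rs_dom_dense rB) => [r s sr Br|r s s0 sr Br].
  exact: (smooth_in_continuous smooth_isoE (DB sr Br)).
have [oB dB _ _] := rB; pose t := r - s ^+ 2.
have rE : r = t + s ^+ 2 by rewrite subrK.
have nw : \forall x \near s,
    p (t + x ^+ 2, x) - x * p2 (t + x ^+ 2, x) = - u t.
  near=> x; rewrite wu; first by rewrite addrK.
  - by near: x; apply: open_nbhs_nbhs; split=> //; exact: open_neq.
  - by rewrite ltrDr subr_gt0.
  - near: x; have : (t + x ^+ 2) @[x --> s] --> t + s ^+ 2.
      by apply: cvgD; [exact: cvg_cst | exact: exprn_continuous].
    by move/(_ B); apply; apply: open_nbhs_nbhs; split=> //; rewrite -rE.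
have Us : U (t + s ^+ 2, s) by rewrite -rE; apply: DB => //; exact: ltW.
have := derive_val (is_derive := is_derive_characteristic Us).
rewrite (near_eq_derive _ nw) -rE => E; apply/eqP.
have : s * isoE (r, s) == 0 by rewrite -oppr_eq0 -E derive_cst.
by rewrite mulf_eq0 (negbTE s0).
Unshelve. all: by end_near. Qed.

Variable G : 'I_n -> 'rV[R]_n * 'rV[R]_n -> R.
Hypothesis GE : forall i z, slit Omega z -> G i z = spray_coef p i z.

Let oO : open Omega. Proof. exact: radial_open rB. Qed.

Lemma isotropic_isoE : isotropic_curvature Omega G <->
  forall r s : R, s ^+ 2 <= r -> B r -> isoE (r, s) = 0.
Proof.
rewrite (isotropic_flat oO oU DU sp GE hn).
have key k z : slit Omega z -> flatQy p k z - 2 * flatPx p k z =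
    enorm z.2 * isoE (rs_of z) * (z.1 0 k - (rs_of z).2 * z.2 0 k / enorm z.2).
  move=> [_ y0]; rewrite /flatQy /flatPx /isoE.
  by field; exact: enorm_neq0.
split=> [H|H k z sz].
  apply: (rs_dom_dense rB) => [r s sr Br|r s s0 sr Br].
    exact: (smooth_in_continuous smooth_isoE (DB sr Br)).
  have [z [sz zE N1 [x0 _ y0 _]]] := rs_witness hn rB (ltW sr) Br.
  (* At the witness the first coordinate of [x - s y / |y|] is [sqrt r - s^2 / sqrt r], which is
     nonzero exactly because [s^2 < r]. *)
  have := key (Ordinal (ltnW hn)) z sz.
  rewrite H// subrr zE N1 x0 y0/= mul1r divr1 => /esym/eqP.
  have r0 : 0 < r by apply: le_lt_trans sr; exact: sqr_ge0.
  rewrite mulf_eq0 => /orP[/eqP//|].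
  have q0 : Num.sqrt r != 0 by rewrite gt_eqF// sqrtr_gt0.
  rewrite -(mulIr_eq0 _ (mulIf q0)) mulrBl mulrA divfK// -!expr2 sqr_sqrtr ?ltW//.
  by rewrite subr_eq0 gt_eqF.
apply/eqP; rewrite -subr_eq0 key//.
have : rs_dom Omega (rs_of z) by exists z.
case: (rs_of z) => r s /(rs_domE hn rB)[sr Br].
by rewrite H// mulr0 mul0r.
Qed.

Lemma zero_PDE : zero_curvature Omega G <->
  forall r s : R, s ^+ 2 <= r -> B r ->
    2 * p1 (r, s) = p (r, s) * p2 (r, s) /\
    p2 (r, s) + s * p (r, s) * p2 (r, s) = p (r, s) ^+ 2.
Proof.
rewrite (zero_flat oO oU DU sp GE hn).
have keyQ (z : 'rV[R]_n * 'rV[R]_n) : flatP p z ^+ 2 - flatQ p z = enorm z.2 ^+ 2 *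
    (p (rs_of z) ^+ 2 - (2 * (rs_of z).2 * p1 (rs_of z) + p2 (rs_of z))).
  by rewrite /flatP /flatQ; ring.
have keyP k z : slit Omega z -> flatP p z * flatPy p k z - flatPx p k z =
    enorm z.2 * z.1 0 k * (p (rs_of z) * p2 (rs_of z) - 2 * p1 (rs_of z)) +
    z.2 0 k * (p (rs_of z) ^+ 2 - (p2 (rs_of z)
       + (rs_of z).2 * p (rs_of z) * p2 (rs_of z))).
  move=> [_ y0]; rewrite /flatP /flatPy /flatPx.
  by field; exact: enorm_neq0.
split=> [H|H z sz].
  pose F1 z := p z * p2 z - 2 * p1 z.
  pose F2 z := p z ^+ 2 - (p2 z + z.2 * p z * p2 z).
  have sF1 : smooth_in U F1.
    apply: smooth_inB => //; apply: smooth_inM => //; exact: smooth_in_cst.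
  have sF2 : smooth_in U F2.
    apply: smooth_inB => //; first by under eq_fun do rewrite expr2; exact: smooth_inM.
    apply: smooth_inD => //; apply: smooth_inM => //; apply: smooth_inM => //.
    exact: smooth_in_s.
  have F0 r s : s != 0 -> s ^+ 2 < r -> B r -> F1 (r, s) = 0 /\ F2 (r, s) = 0.
    move=> s0 sr Br.
    have r0 : 0 < r by apply: le_lt_trans sr; exact: sqr_ge0.
    have [z [sz zE N1 [x0 x1 y0 y1]]] := rs_witness hn rB (ltW sr) Br.
    have HP k : flatP p z * flatPy p k z - flatPx p k z = 0.
      by rewrite -(H z sz).2 subrr.
    (* The second coordinate isolates [F2]: it is [0] for [x] and nonzero for [y]. With [F2] gone,
       the first coordinate, where [x] has [sqrt r], isolates [F1]. *)
    have F20 : F2 (r, s) = 0.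
      have := HP (Ordinal hn); rewrite keyP// x1 mulr0 mul0r add0r y1 zE => /eqP.
      rewrite mulf_eq0 => /orP[|/eqP//].
      by rewrite sqrtr_eq0 subr_le0 leNgt ltr_pdivrMr// mul1r sr.
    split=> //; have := HP (Ordinal (ltnW hn)).
    rewrite keyP// x0 N1 mul1r zE -/(F2 (r, s)) F20 mulr0 addr0 => /eqP.
    by rewrite mulf_eq0 sqrtr_eq0 leNgt r0/= => /eqP.
  have F10' := @rs_dom_dense _ _ _ _ rB F1
    (fun r s sr Br => smooth_in_continuous sF1 (DB sr Br))
    (fun r s s0 sr Br => (F0 r s s0 sr Br).1).
  have F20' := @rs_dom_dense _ _ _ _ rB F2
    (fun r s sr Br => smooth_in_continuous sF2 (DB sr Br))
    (fun r s s0 sr Br => (F0 r s s0 sr Br).2).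
  move=> r s sr Br; have := F10' r s sr Br; have := F20' r s sr Br.
  by rewrite /F1 /F2/= => ? ?; split; lra.
have : rs_dom Omega (rs_of z) by exists z.
have := keyQ z; have := fun k => keyP k z sz.
case: (rs_of z) => r s; rewrite /= => kP kQ /(rs_domE hn rB)[sr Br].
have [H1 H2] := H r s sr Br.
split=> [|k]; apply/eqP; rewrite -subr_eq0; last first.
  by rewrite -oppr_eq0 opprB kP H1 H2 !subrr !mulr0 addr0.
(* The first equation, multiplied by [s], turns the left side of the second into [2 s p_r + p_s],
   that is, into [Q / |y|^2]. *)
have E : 2 * s * p1 (r, s) = s * p (r, s) * p2 (r, s).
  by rewrite -[RHS]mulrA -H1; ring.
by rewrite kQ -H2 E [_ + p2 _]addrC subrr mulr0.
Qed.

End Profile.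

(** * Integrals over parabolic arcs *)

Section QuadraticRemainder.
Context {R : realType} {V : normedModType R}.

(** Differentiability is reached through an explicit quadratic bound because, unlike a little-o,
    such a bound passes directly through an integral. *)
Lemma differentiable_quadratic (f l : V -> R) z (K : R) : linear l -> continuous l ->
  0 <= K ->
  (\forall h \near (0 : V), `|f (h + z) - (f z + l h)| <= K * `|h| ^+ 2) ->
  differentiable f z /\ forall h, 'D_h f z = l h.
Proof.
move=> ll cl K0 HK; pose LM := GRing.isLinear.Build _ _ _ _ _ ll.
pose L : {linear V -> R} := HB.pack l LM.
have cL : continuous L by exact: cl.
have E : f \o shift z = cst (f z) + L +o_ 0 id.
  apply/eqaddoP => e e0.
  have K1 : 0 < K + 1 by rewrite ltr_wpDl.
  near=> h.
  rewrite -[X in `|X|]/(f (h + z) - (f z + l h)).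
  apply: (@le_trans _ _ (K * `|h| ^+ 2)); first by near: h.
  rewrite expr2 mulrA ler_wpM2r//.
  have hK : `|h| <= e / (K + 1).
    near: h; apply/nbhs_ballP; exists (e / (K + 1)); first by rewrite /= divr_gt0.
    by move=> h; rewrite -ball_normE/= sub0r normrN => /ltW.
  move: hK; rewrite ler_pdivlMr// mulrDr mulr1 => hK.
  by have := normr_ge0 h; lra.
have dE := diff_unique cL E.
have df : differentiable f z by apply/diff_locallyP; rewrite dE.
by split=> // h; rewrite deriveE// dE.
Unshelve. all: by end_near. Qed.

End QuadraticRemainder.

Section UnitIntegral.
Context {R : realType}.
Implicit Types (f g H : R -> R).

Definition cont01 f : Prop := forall x : R, 0 <= x <= 1 -> {for x, continuous f}.

Definition int01 f : R := \int[@lebesgue_measure R]_(x in `[0, 1]) f x.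

Lemma cont01_within f : cont01 f -> {within `[0, 1], continuous f}.
Proof.
move=> cf; apply: continuous_in_subspaceT => x; rewrite inE/= in_itv/=; exact: cf.
Qed.

Lemma cont01_integrable f : cont01 f ->
  (@lebesgue_measure R).-integrable `[0, 1] (EFin \o f).
Proof.
move=> cf; apply: continuous_compact_integrable; first exact: segment_compact.
exact: cont01_within.
Qed.

Lemma int01_eq f g : (forall x : R, 0 <= x <= 1 -> f x = g x) -> int01 f = int01 g.
Proof.
by move=> fg; apply: eq_Rintegral => x; rewrite inE/= in_itv/=; exact: fg.
Qed.

Lemma int01B f g : cont01 f -> cont01 g ->
  int01 (fun x => f x - g x) = int01 f - int01 g.
Proof.
by move=> cf cg; apply: RintegralB; [|exact: cont01_integrable|exact: cont01_integrable].
Qed.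

Lemma int01Z a f : cont01 f -> int01 (fun x => a * f x) = a * int01 f.
Proof. by move=> cf; apply: RintegralZl => //; exact: cont01_integrable. Qed.

Lemma int01_bound f (C : R) : cont01 f -> (forall x : R, 0 <= x <= 1 -> `|f x| <= C) ->
  `|int01 f| <= C.
Proof.
move=> cf fC; have ccst : cont01 (fun=> C) by move=> x _; exact: cst_continuous.
have cn : cont01 (fun x => `|f x|).
  move=> x x01; apply: continuous_comp; first exact: cf.
  exact: norm_continuous.
apply: le_trans (le_normr_Rintegral _ (cont01_integrable cf)) _ => //.
apply: (@le_trans _ _ (int01 (fun=> C))).
  apply: le_Rintegral => //; do ?exact: cont01_integrable.
rewrite /int01 Rintegral_cst//. 
rewrite (_ : fine _ = 1) ?mulr1//; apply: (@congr1 _ _ fine _ 1%E).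
by apply: etrans (lebesgue_measure_itv _) _; rewrite /= lte01 oppr0 adde0.
Qed.

Lemma int01_FTC H f : cont01 f ->
  (forall x : R, 0 <= x <= 1 -> is_derive x (1 : R) H (f x)) ->
  int01 f = H 1 - H 0.
Proof.
move=> cf DH; have cH (x : R) : 0 <= x <= 1 -> {for x, continuous H}.
  by move=> /DH[dH _]; apply/differentiable_continuous/derivable1_diffP.
rewrite /int01 /Rintegral (@continuous_FTC2 _ f H 0 1)//.
- exact: cont01_within.
- split.
  + by move=> x; rewrite in_itv/= => /andP[/ltW x0 /ltW x1]; have [] := DH x ltac:(by rewrite x0).
  + by apply: cvg_at_right_filter; apply: cH; rewrite lexx ler01.
  + by apply: cvg_at_left_filter; apply: cH; rewrite lexx ler01.
- move=> x; rewrite in_itv/= => /andP[/ltW x0 /ltW x1].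
  have Dx := DH x ltac:(by rewrite x0).
  by rewrite derive1E; exact: derive_val.
Qed.

End UnitIntegral.

(** * Differentiation under the integral sign *)

Section ParametricIntegral.
Context {R : realType}.
Variable I : set R.
Hypotheses (oI : open I) (cI : forall a b t : R, I a -> I b -> a <= t <= b -> I t).
Implicit Types (g : R -> R) (m : nat) (z : R * R).

(** As [I] is an interval, the two conditions put all the arguments [r - s^2 x^2] with [0 <= x <= 1]
    in [I]. *)
Definition parab_dom : set (R * R) := [set z | I z.1 /\ I (z.1 - z.2 ^+ 2)].

Lemma open_parab_dom : open parab_dom.
Proof.
have -> : parab_dom = (fst @^-1` I) `&` ((fun z => z.1 - z.2 * z.2) @^-1` I).
  by apply/seteqP; split=> z; rewrite /parab_dom /= expr2.
apply: openI; apply: open_comp => // z _; first exact: cvg_fst.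
apply: (@smooth_in_continuous _ _ setT) => //; apply: smooth_inB; [exact: openT|exact: smooth_in_r|].
by apply: smooth_inM; [exact: openT|exact: smooth_in_s|exact: smooth_in_s].
Qed.

(** Differentiating [g (r - s^2 x^2)] in [s] brings out [- 2 s x^2]; the weight [x^m] makes the
    family stable under this operation. *)
Definition parab_int m g z : R := int01 (fun x : R => x ^+ m * g (z.1 - z.2 ^+ 2 * x ^+ 2)).

Lemma parab_segment z x : parab_dom z -> 0 <= x <= 1 -> I (z.1 - z.2 ^+ 2 * x ^+ 2).
Proof.
move=> [Ir Irs] /andP[x0 x1]; apply: (cI Irs Ir).
have x21 : x ^+ 2 <= 1 by rewrite expr_le1.
by rewrite lerD2l lerN2 ler_piMr ?sqr_ge0//= gerBl mulr_ge0// sqr_ge0.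
Qed.

Lemma cont_parab m g (c d x : R) : {for c - d * x ^+ 2, continuous g} ->
  {for x, continuous (fun x : R => x ^+ m * g (c - d * x ^+ 2))}.
Proof.
move=> cg; apply: continuousM; first exact: exprn_continuous.
apply: (@continuous_comp _ _ _ (fun x : R => c - d * x ^+ 2) g) => //.
apply: cvgB; first exact: cvg_cst.
by apply: cvgM; [exact: cvg_cst | exact: exprn_continuous].
Qed.

Lemma cont01_parab m g z : smooth_in I g -> parab_dom z ->
  cont01 (fun x : R => x ^+ m * g (z.1 - z.2 ^+ 2 * x ^+ 2)).
Proof.
move=> sg Dz x x01; apply: cont_parab.
exact: smooth_in_continuous sg (parab_segment Dz x01).
Qed.

(** Two mean value steps, with the maximum of the absolute second derivative on the segment as
    constant. The bound must be uniform in both points, since it is applied under an integral. *)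
Lemma taylor1_bound g (a b : R) : smooth_in I g -> I a -> I b -> a <= b ->
  exists2 M, 0 <= M & forall t t' : R, a <= t <= b -> a <= t' <= b ->
    `|g t' - g t - 'D_1 g t * (t' - t)| <= M * (t' - t) ^+ 2.
Proof.
move=> sg Ia Ib ab; have sg1 := smooth_in_derive (1 : R) sg.
have sg2 := smooth_in_derive (1 : R) sg1.
have Iab (t : R) : a <= t <= b -> I t by exact: cI.
have [g2 g2E] : exists g2, 'D_1 ('D_1 g) = g2 by eexists.
rewrite g2E in sg2.
have [|c _ Mc] := @EVT_max R (fun t => `|g2 t|) a b ab.
  apply: continuous_in_subspaceT => x; rewrite inE/= in_itv/= => /Iab Ix.
  exact: cvg_norm (smooth_in_continuous sg2 Ix).
exists `|g2 c| => // t t' tab t'ab.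
have mvt (f : R -> R) x y : smooth_in I f -> a <= x <= b -> a <= y <= b ->
    exists2 w, (a <= w <= b /\ `|w - x| <= `|y - x|) & f y - f x = 'D_1 f w * (y - x).
  move=> sf /andP[ax xb] /andP[ay yb].
  have [xy|yx|<-] := ltgtP x y; last first.
  - by exists x; rewrite ?ax ?subrr// mulr0.
  - have [|w /andP[yw wx] E] := @MVT_cc _ f ('D_1 f) y x yx.
      move=> w /andP[yw wx]; apply/is_derive_diff/(smooth_in_diff sf)/Iab.
      by rewrite (le_trans ay yw) (le_trans wx xb).
    exists w; last by rewrite -opprB E -mulrN opprB.
    split; first by rewrite (le_trans ay (ltW yw)) (le_trans (ltW wx) xb).
    by rewrite !ltr0_norm ?subr_lt0//; lra.
  - have [|w /andP[xw wy] E] := @MVT_cc _ f ('D_1 f) x y xy.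
      move=> w /andP[xw wy]; apply/is_derive_diff/(smooth_in_diff sf)/Iab.
      by rewrite (le_trans ax xw) (le_trans wy yb).
    exists w => //.
    split; first by rewrite (le_trans ax (ltW xw)) (le_trans (ltW wy) yb).
    by rewrite !gtr0_norm ?subr_gt0//; lra.
have [w [wab wt] ->] := mvt g t t' sg tab t'ab.
rewrite -mulrBl; have [w' [w'ab _]] := mvt _ t w sg1 tab wab.
have -> : 'D_1 ('D_1 g) w' = g2 w' by rewrite -g2E.
move=> ->; have Mw : `|g2 w'| <= `|g2 c| by apply: Mc; rewrite in_itv.
rewrite !normrM -mulrA ler_pM//.
by rewrite -[_ ^+ 2]real_normK ?num_real// expr2 ler_pM.
Qed.

Lemma norm_pair_ge (h : R * R) : `|h.1| <= `|h| /\ `|h.2| <= `|h|.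
Proof. by rewrite prod_normE /= !le_max !lexx orbT. Qed.

Lemma sqr_le_norm (x y : R) : `|x| <= y -> x ^+ 2 <= y ^+ 2.
Proof.
move=> xy; have y0 : 0 <= y by exact: le_trans xy.
by rewrite -[leLHS]real_normK ?num_real// ler_pXn2r ?nnegrE.
Qed.

Lemma near0_norm_le (e : R) : 0 < e -> \forall h \near (0 : R * R), `|h| <= e.
Proof.
move=> e0; apply/nbhs_ballP; exists e => //= h.
by rewrite -ball_normE/= sub0r normrN => /ltW.
Qed.

(** The differential predicted by formal differentiation under the integral sign. *)
Definition parab_diff m g z (h : R * R) : R :=
  h.1 * parab_int m ('D_1 g) z - 2 * z.2 * h.2 * parab_int m.+2 ('D_1 g) z.

(** The argument of [g] moves by [h.1 - (2 z.2 h.2 + h.2^2) x^2]. The part linear in [h] is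
    accounted for by [parab_diff], and the part in [h.2^2] gives the last term, already
    quadratic. *)
Lemma parab_int_remainder m g z (h : R * R) : smooth_in I g ->
  parab_dom z -> parab_dom (h + z) ->
  parab_int m g (h + z) - (parab_int m g z + parab_diff m g z h)
  = int01 (fun x : R => x ^+ m * (g ((h + z).1 - (h + z).2 ^+ 2 * x ^+ 2)
        - g (z.1 - z.2 ^+ 2 * x ^+ 2)
        - 'D_1 g (z.1 - z.2 ^+ 2 * x ^+ 2) *
          ((h + z).1 - (h + z).2 ^+ 2 * x ^+ 2 - (z.1 - z.2 ^+ 2 * x ^+ 2))))
    - h.2 ^+ 2 * parab_int m.+2 ('D_1 g) z.
Proof.
move=> sg Dz Dhz; have sg1 := smooth_in_derive (1 : R) sg.
have c1 := @cont01_parab m _ _ sg Dhz; have c2 := @cont01_parab m _ _ sg Dz.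
have c3 := @cont01_parab m _ _ sg1 Dz; have c4 := @cont01_parab m.+2 _ _ sg1 Dz.
pose k := 2 * z.2 * h.2 + h.2 ^+ 2.
transitivity (parab_int m g (h + z) - parab_int m g z - (h.1 * parab_int m ('D_1 g) z
   - k * parab_int m.+2 ('D_1 g) z) - h.2 ^+ 2 * parab_int m.+2 ('D_1 g) z).
  by rewrite /parab_diff /k; ring.
congr (_ - _).
have cZ a f : cont01 f -> cont01 (fun x => a * f x).
  by move=> cf x /cf cx; apply: cvgM => //; exact: cvg_cst.
have cB (f1 f2 : R -> R) : cont01 f1 -> cont01 f2 -> cont01 (fun x => f1 x - f2 x).
  by move=> cf1 cf2 x x01; apply: cvgB; [exact: cf1 | exact: cf2].
rewrite /parab_int -!int01Z// -!int01B//; do ?[apply: cB => //]; do ?[exact: cZ].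
apply: int01_eq => x _ /=; rewrite /k !exprS; ring.
Qed.

Lemma parab_diff_linear m g z : linear (parab_diff m g z).
Proof. by move=> a x y; rewrite /parab_diff/= /GRing.scale/=; ring. Qed.

Lemma parab_diff_continuous m g z : continuous (parab_diff m g z).
Proof.
move=> h; apply: (@smooth_in_continuous _ _ setT) => //.
apply: smooth_inB; first exact: openT.
  by apply: smooth_inM; [exact: openT|exact: smooth_in_r|exact: smooth_in_cst].
apply: smooth_inM; [exact: openT| |exact: smooth_in_cst].
by apply: smooth_inM; [exact: openT|exact: smooth_in_cst|exact: smooth_in_s].
Qed.

Lemma parab_int_estimate m g z : smooth_in I g -> parab_dom z ->
  exists2 K, 0 <= K & \forall h \near (0 : R * R),
    `|parab_int m g (h + z) - (parab_int m g z + parab_diff m g z h)| <= K * `|h| ^+ 2.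
Proof.
move=> sg Dz; have [Ir Irs] := Dz.
(* The margin [d] provides one compact segment inside [I] for the arguments at [z] and at all nearby
   points [h + z]. *)
have [d d0 [Id1 Id2]] : exists2 d : R, 0 < d & I (z.1 + d) /\ I (z.1 - z.2 ^+ 2 - d).
  have c1 : (z.1 + d) @[d --> (0 : R)^'+] --> z.1.
    rewrite -{2}[z.1]addr0; apply: cvgD; first exact: cvg_cst.
    by apply: cvg_at_right_filter; exact: cvg_id.
  have c2 : (z.1 - z.2 ^+ 2 - d) @[d --> (0 : R)^'+] --> z.1 - z.2 ^+ 2.
    rewrite -{2}[z.1 - z.2 ^+ 2]subr0; apply: cvgB; first exact: cvg_cst.
    by apply: cvg_at_right_filter; exact: cvg_id.
  have n1 : \forall d \near (0 : R)^'+, I (z.1 + d).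
    exact: c1 I (open_nbhs_nbhs (conj oI Ir)).
  have n2 : \forall d \near (0 : R)^'+, I (z.1 - z.2 ^+ 2 - d).
    exact: c2 I (open_nbhs_nbhs (conj oI Irs)).
  have n0 : \forall d \near (0 : R)^'+, 0 < d by exact: nbhs_right_gt.
  have n : \forall d \near (0 : R)^'+, [/\ 0 < d, I (z.1 + d) & I (z.1 - z.2 ^+ 2 - d)].
    by apply: filterS3 n0 n1 n2 => d.
  have [d [d3 d1 d2]] := @filter_ex _ _ _ _ n.
  by exists d.
set a := z.1 - z.2 ^+ 2 - d in Id2; set b := z.1 + d in Id1.
have z20 := sqr_ge0 z.2.
have ab : a <= b.
  apply: (@le_trans _ _ z.1); last by rewrite lerDl ltW.
  by rewrite /a -addrA gerDl -opprD oppr_le0 addr_ge0// ltW.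
have [M M0 HM] := taylor1_bound sg Id2 Id1 ab.
(* For [|h| <= 1] the argument of [g] moves by at most [C |h|]: a share [1] comes from [h.1], and
   [2 |z.2| + 1] from [h.2]. In the constant below, the first summand bounds the Taylor remainder
   and the second the term in [h.2^2]. *)
pose C := 2 * `|z.2| + 2.
have C0 : 0 < C by rewrite /C; have := normr_ge0 z.2; lra.
exists (M * C ^+ 2 + `|parab_int m.+2 ('D_1 g) z|).
  by rewrite addr_ge0// mulr_ge0// sqr_ge0.
have cshift : (h + z) @[h --> (0 : R * R)] --> z.
  by rewrite -{2}[z]add0r; apply: cvgD; [exact: cvg_id | exact: cvg_cst].
near=> h.
have Dhz : parab_dom (h + z).
  near: h; apply: (cshift parab_dom); exact: open_nbhs_nbhs (conj open_parab_dom Dz).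
have hd : `|h| <= d / C.
  by near: h; apply: near0_norm_le; rewrite divr_gt0.
have h1 : `|h| <= 1 by near: h; exact: near0_norm_le.
have [h1n h2n] := norm_pair_ge h.
have Ch : C * `|h| <= d by rewrite mulrC -ler_pdivlMr.
rewrite parab_int_remainder//.
have key (x : R) : 0 <= x <= 1 ->
    let t := z.1 - z.2 ^+ 2 * x ^+ 2 in
    let t' := (h + z).1 - (h + z).2 ^+ 2 * x ^+ 2 in
    [/\ a <= t <= b, a <= t' <= b & `|t' - t| <= C * `|h|].
  move=> /andP[x0 x1] t t'.
  have x20 : 0 <= x ^+ 2 by exact: sqr_ge0.
  have x21 : x ^+ 2 <= 1 by rewrite expr_le1.
  have tt : `|t' - t| <= C * `|h|.
    have -> : t' - t = h.1 - (2 * z.2 * h.2 + h.2 * h.2) * x ^+ 2.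
      by rewrite /t /t' /=; ring.
    apply: le_trans (ler_normB _ _) _.
    have : `|(2 * z.2 * h.2 + h.2 * h.2) * x ^+ 2| <= (2 * `|z.2| + 1) * `|h|.
      rewrite normrM [`|x ^+ 2|]ger0_norm// -[leRHS]mulr1 ler_pM//.
      apply: le_trans (ler_normD _ _) _; rewrite [leRHS]mulrDl lerD//.
        by rewrite !normrM [`|2|]ger0_norm// ler_wpM2l// mulr_ge0.
      by rewrite normrM ler_pM// (le_trans h2n).
    by rewrite /C; lra.
  have ab1 : z.1 - z.2 ^+ 2 <= t <= z.1.
    by rewrite /t lerD2l lerN2 ler_piMr//= gerBl mulr_ge0.
  by move: tt; rewrite ler_norml /a /b => /andP[? ?]; move/andP: ab1 => [? ?]; split;
     rewrite ?ler_norml; lra.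
have sg1 := smooth_in_derive (1 : R) sg.
apply: le_trans (ler_normB _ _) _; rewrite [leRHS]mulrDl; apply: lerD; last first.
  rewrite normrM mulrC ler_wpM2l// normrX lerXn2r ?nnegrE//.
apply: int01_bound => [x x01|x x01].
  apply: cvgM; first exact: exprn_continuous.
  have cp w : {for x, continuous (fun x : R => w.1 - w.2 ^+ 2 * x ^+ 2)}.
    apply: cvgB; first exact: cvg_cst.
    by apply: cvgM; [exact: cvg_cst | exact: exprn_continuous].
  have cc (f : R -> R) w : smooth_in I f -> parab_dom w ->
      {for x, continuous (fun x : R => f (w.1 - w.2 ^+ 2 * x ^+ 2))}.
    move=> sf Dw; apply: (@continuous_comp _ _ _ (fun x : R => w.1 - w.2 ^+ 2 * x ^+ 2) f).
      exact: cp.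
    exact: smooth_in_continuous sf (parab_segment Dw x01).
  apply: cvgB.
    by apply: cvgB; [exact: (cc g (h + z)) | exact: (cc g z)].
  apply: cvgM; first exact: (cc ('D_1 g) z).
  by apply: cvgB; [exact: (cp (h + z)) | exact: (cp z)].
have [tab t'ab tt] := key x x01.
have /andP[x0 x1] := x01.
rewrite normrM -[leRHS]mul1r ler_pM//.
  by rewrite normrX exprn_ile1// ger0_norm.
apply: le_trans (HM _ _ tab t'ab) _.
rewrite -mulrA; apply: ler_wpM2l => //.
by rewrite -[leRHS]exprMn; exact: sqr_le_norm.
Unshelve. all: by end_near. Qed.

Lemma parab_int_differentiable m g z : smooth_in I g -> parab_dom z ->
  differentiable (parab_int m g) z /\
  forall h, 'D_h (parab_int m g) z = parab_diff m g z h.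
Proof.
move=> sg Dz; have [K K0 HK] := parab_int_estimate m sg Dz.
apply: (differentiable_quadratic _ _ K0 HK); first exact: parab_diff_linear.
exact: parab_diff_continuous.
Qed.

(* The algebra generated by the smooth functions and the integrals [parab_int m g]
   is stable under derivation, whence the coinduction. *)
Inductive parab_gen : (R * R -> R) -> Prop :=
| parab_gen_int m g : smooth_in I g -> parab_gen (parab_int m g)
| parab_gen_smooth f : smooth_in parab_dom f -> parab_gen f
| parab_gen_add f h : parab_gen f -> parab_gen h -> parab_gen (fun z => f z + h z)
| parab_gen_mul f h : parab_gen f -> parab_gen h -> parab_gen (fun z => f z * h z).

Lemma parab_gen_diff f z : parab_gen f -> parab_dom z -> differentiable f z.
Proof.
move=> gf Dz; elim: gf => {f}.
- by move=> m g sg; have [] := parab_int_differentiable m sg Dz.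
- by move=> f sf; exact: smooth_in_diff Dz.
- by move=> f g _ df _ dg; exact: differentiableD.
- by move=> f g _ df _ dg; exact: differentiableM.
Qed.

Lemma parab_gen_derive f v : parab_gen f ->
  exists2 g, parab_gen g & forall z, parab_dom z -> 'D_v f z = g z.
Proof.
elim => {f}.
- move=> m g sg; have sg1 := smooth_in_derive (1 : R) sg.
  exists (fun z => v.1 * parab_int m ('D_1 g) z
     + (-2 * v.2) * z.2 * parab_int m.+2 ('D_1 g) z).
    apply: parab_gen_add; apply: parab_gen_mul; try exact: parab_gen_int.
      by apply: parab_gen_smooth; exact: smooth_in_cst.
    apply: parab_gen_smooth; apply: smooth_inM.
    + exact: open_parab_dom.
    + exact: smooth_in_cst.
    + exact: smooth_in_s.
  move=> z Dz; have [_ ->] := parab_int_differentiable m sg Dz.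
  by rewrite /parab_diff; ring.
- move=> f sf; exists ('D_v f) => //; apply: parab_gen_smooth.
  exact: smooth_in_derive.
- move=> f g gf [f' gf' f'E] gg [g' gg' g'E].
  exists (fun x => f' x + g' x); first exact: parab_gen_add.
  move=> x Ux; rewrite -f'E// -g'E//; apply: deriveD; apply: diff_derivable;
    exact: parab_gen_diff Ux.
- move=> f g gf [f' gf' f'E] gg [g' gg' g'E].
  exists (fun x => f x * g' x + g x * f' x).
    by apply: parab_gen_add; exact: parab_gen_mul.
  move=> x Ux; rewrite -f'E// -g'E//; apply: deriveM; apply: diff_derivable;
    exact: parab_gen_diff Ux.
Qed.

Lemma smooth_in_parab_int m g : smooth_in I g -> smooth_in parab_dom (parab_int m g).
Proof.
move=> sg; apply: (@smooth_in_coind _ _ parab_gen _ open_parab_dom).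
- by move=> f x; exact: parab_gen_diff.
- by move=> f v; exact: parab_gen_derive.
- exact: parab_gen_int.
Qed.

(** The function is the integral of [g (r - sigma^2)] over [sigma] from [0] to [s], rescaled by
    [sigma = s x]. Avoiding the change of variables keeps [s = 0] included. *)
Lemma is_derive_parab_primitive g r s : smooth_in I g -> parab_dom (r, s) ->
  is_derive s (1 : R) (fun s => s * parab_int 0 g (r, s)) (g (r - s ^+ 2)).
Proof.
move=> sg Dz; have sg1 := smooth_in_derive (1 : R) sg.
have [df DE] := parab_int_differentiable 0 sg Dz.
apply: is_derive_eq.
  apply: is_derive_mul (is_derive_id _ _) _.
  exact: (is_derive_comp2 df (is_derive_cst r _ _) (is_derive_id _ _)).
rewrite mul0r add0r !mul1r DE /parab_diff/= mul0r add0r mulr1.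
have c0 := @cont01_parab 0 _ _ sg Dz; have c2 := @cont01_parab 2 _ _ sg1 Dz; move: c0 c2 => /= c0 c2.
(* Differentiating under the integral produces the integrand [f], which is the exact derivative in
   [x] of [x g (r - s^2 x^2)]; only the end point [x = 1] contributes. *)
pose f (x : R) := x ^+ 0 * g (r - s ^+ 2 * x ^+ 2)
     - (2 * s ^+ 2) * (x ^+ 2 * 'D_1 g (r - s ^+ 2 * x ^+ 2)).
have cf : cont01 f.
  move=> x x01; apply: cvgB; first exact: c0.
  by apply: cvgM; [exact: cvg_cst | exact: c2].
have Df (x : R) : 0 <= x <= 1 ->
    is_derive x (1 : R) (fun x : R => x * g (r - s ^+ 2 * x ^+ 2)) (f x).
  move=> x01.
  have Dg : is_derive (r - s ^+ 2 * x ^+ 2) (1 : R) g ('D_1 g (r - s ^+ 2 * x ^+ 2)).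
    exact: is_derive_diff (smooth_in_diff sg (parab_segment Dz x01)).
  have Di := is_derive_sub (is_derive_cst r _ _)
    (is_derive_mul (is_derive_cst (s ^+ 2) _ _) (is_deriveX 2 (is_derive_id x (1 : R)))).
  refine (is_derive_eq (is_derive_mul (is_derive_id _ _)
    (is_derive_comp1 (p := g) (f := fun x : R => r - s ^+ 2 * x ^+ 2) Dg Di)) _).
  rewrite /f /= /GRing.scale/=; move: (g _) ('D_1 g _) => *; ring.
have <- : int01 f = g (r - s ^+ 2).
  by rewrite (int01_FTC cf Df) mul1r mul0r subr0 expr1n mulr1.
rewrite int01B//; last by move=> x x01; apply: cvgM; [exact: cvg_cst | exact: c2].
rewrite int01Z// /parab_int/=; ring.
Qed.

End ParametricIntegral.

(** * Zero curvature *)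

Section CubicODE.
Context {R : realType}.
Variables (B : set R) (phi : R -> R).
Hypothesis dB : forall s t : R, B t -> s <= t -> B s.
Hypothesis ode : forall t : R, 0 <= t -> B t ->
  is_derive t (1 : R) phi (phi t ^+ 3 / 2).

Lemma cubic_ode_continuous (t : R) : 0 <= t -> B t -> {for t, continuous phi}.
Proof.
by move=> t0 Bt; have [d _] := ode t0 Bt; apply/differentiable_continuous/derivable1_diffP.
Qed.

(* [F := phi ^+ 2 * (1 - phi 0 ^+ 2 * t) - phi 0 ^+ 2] satisfies the linear
   equation [F' = phi ^+ 2 * F], so [F ^+ 2 * expR (- 2 * M * t)] is
   nonincreasing for any upper bound [M] of [phi ^+ 2]. *)
Lemma cubic_ode_invariant (T : R) : 0 <= T -> B T ->
  phi T ^+ 2 * (1 - phi 0 ^+ 2 * T) = phi 0 ^+ 2.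
Proof.
rewrite le_eqVlt => /predU1P[<- _|T0 BT]; first by rewrite mulr0 subr0 mulr1.
have BB (t : R) : t <= T -> B t by exact: dB.
have [c _ Mc] : exists2 c, c \in `[0, T] & forall t, t \in `[0, T] -> phi t ^+ 2 <= phi c ^+ 2.
  apply: (@EVT_max R (fun t => phi t ^+ 2)); first exact: ltW.
  apply: continuous_in_subspaceT => t; rewrite inE/= in_itv/= => /andP[t0 tT].
  have ct := cubic_ode_continuous t0 (BB t tT).
  by rewrite /continuous_at; under eq_fun do rewrite expr2; rewrite expr2; exact: cvgM.
pose M := phi c ^+ 2; pose F t := phi t ^+ 2 * (1 - phi 0 ^+ 2 * t) - phi 0 ^+ 2.
have DF (t : R) : 0 <= t <= T -> is_derive t (1 : R) F (phi t ^+ 2 * F t).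
  move=> /andP[t0 tT]; have Dp := ode t0 (BB t tT).
  have Dl : is_derive t (1 : R) (fun t : R => 1 - phi 0 ^+ 2 * t) (- phi 0 ^+ 2).
    refine (is_derive_eq (is_derive_sub (is_derive_cst (1 : R) _ _)
      (is_derive_mul (is_derive_cst _ _ _) (is_derive_id _ _))) _).
    by rewrite /= mul0r mulr1 !add0r.
  have -> : F = fun t => phi t * phi t * (1 - phi 0 ^+ 2 * t) - phi 0 ^+ 2.
    by apply/funext => x; rewrite /F -expr2.
  refine (is_derive_eq (is_derive_sub (is_derive_mul (is_derive_mul Dp Dp) Dl)
    (is_derive_cst _ _ _)) _).
  by rewrite /=; field.
have De (t : R) : is_derive t (1 : R) (fun t : R => expR (- (2 * M) * t))
    (- (2 * M) * expR (- (2 * M) * t)).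
  refine (is_derive_eq (is_derive_comp1 (f := fun t : R => - (2 * M) * t)
    (is_derive_expR _) (is_derive_mul (is_derive_cst (- (2 * M)) _ _)
    (is_derive_id _ _))) _).
  by rewrite /= mul0r add0r mulr1.
have [|t /andP[/ltW t0 /ltW tT]] := @MVT_cc R (fun t => F t * F t * expR (- (2 * M) * t))
    (fun t => (phi t ^+ 2 * F t * F t + F t * (phi t ^+ 2 * F t)) * expR (- (2 * M) * t)
        + F t * F t * (- (2 * M) * expR (- (2 * M) * t))) 0 T T0.
  by move=> t t01; exact: is_derive_mul (is_derive_mul (DF t t01) (DF t t01)) (De t).
have -> : F 0 = 0 by rewrite /F mulr0 subr0 mulr1 subrr.
rewrite !mul0r !subr0 => E.
have E0 : F T * F T * expR (- (2 * M) * T) <= 0.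
  rewrite E; have -> : (phi t ^+ 2 * F t * F t + F t * (phi t ^+ 2 * F t)) * expR (- (2 * M) * t)
        + F t * F t * (- (2 * M) * expR (- (2 * M) * t)) =
     - (2 * (M - phi t ^+ 2) * F t ^+ 2 * expR (- (2 * M) * t)) by ring.
  have M1 : 0 <= M - phi t ^+ 2 by rewrite subr_ge0; apply: Mc; rewrite in_itv/= t0.
  rewrite mulNr oppr_le0; apply: mulr_ge0; last exact: ltW.
  apply: mulr_ge0; last exact: expR_ge0.
  by apply: mulr_ge0; [exact: mulr_ge0 | exact: sqr_ge0].
move: E0; rewrite pmulr_lle0 ?expR_gt0// -expr2 => F2.
have : F T ^+ 2 = 0 by apply/eqP; rewrite eq_le F2 sqr_ge0.
by move/eqP; rewrite sqrf_eq0 /F subr_eq0 => /eqP.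
Qed.

Lemma cubic_ode_zero (T : R) : phi 0 = 0 -> 0 <= T -> B T -> phi T = 0.
Proof.
move=> p0 T0 BT; have := cubic_ode_invariant T0 BT.
rewrite p0 expr0n/= mul0r subr0 mulr1 => /eqP; rewrite sqrf_eq0.
by move/eqP.
Qed.

(** When [phi 0 != 0], the invariant shows that [phi] has no zero and that [1 - phi 0 ^+ 2 * T] is
    positive. It gives [|phi T|], and the intermediate value theorem gives the sign. *)
Lemma cubic_ode_nonzero (T : R) : phi 0 != 0 -> 0 <= T -> B T ->
  T < phi 0 ^- 2 /\
  phi T = (-1) ^+ (phi 0 < 0)%R / Num.sqrt (phi 0 ^- 2 - T).
Proof.
move=> p0 T0 BT.
have c0 : 0 < phi 0 ^+ 2 by rewrite lt_def sqr_ge0 sqrf_eq0 p0.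
have pos (t : R) : 0 <= t -> B t -> 0 < 1 - phi 0 ^+ 2 * t /\ 0 < phi t ^+ 2.
  move=> t0 Bt; have E := cubic_ode_invariant t0 Bt.
  have := c0; rewrite -[X in 0 < X]E => P.
  have p2 : 0 < phi t ^+ 2.
    rewrite lt_def sqr_ge0 andbT; apply/eqP => p20.
    by move: P; rewrite p20 mul0r ltxx.
  by split=> //; move: P; rewrite pmulr_rgt0.
have [P1 P2] := pos T T0 BT.
have TE : T < phi 0 ^- 2 by rewrite -div1r ltr_pdivlMr//; lra.
split=> //.
have sgE : (phi T < 0) = (phi 0 < 0).
  apply/idP/idP => h; rewrite ltNge; apply/negP => h'.
  - have [||x] := @IVT R phi 0 T 0 T0.
    + apply: continuous_in_subspaceT => t; rewrite inE/= in_itv/= => /andP[t0 tT].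
      exact: cubic_ode_continuous t0 (dB BT tT).
    + by rewrite ge_min le_max h' (ltW h) orbT.
    rewrite in_itv/= => /andP[x0 xT] px; have [_] := pos x x0 (dB BT xT).
    by rewrite px expr0n ltxx.
  - have [||x] := @IVT R phi 0 T 0 T0.
    + apply: continuous_in_subspaceT => t; rewrite inE/= in_itv/= => /andP[t0 tT].
      exact: cubic_ode_continuous t0 (dB BT tT).
    + by rewrite ge_min le_max h' (ltW h) orbT.
    rewrite in_itv/= => /andP[x0 xT] px; have [_] := pos x x0 (dB BT xT).
    by rewrite px expr0n ltxx.
have nE : `|phi T| = (Num.sqrt (phi 0 ^- 2 - T))^-1.
  rewrite -sqrtr_sqr -sqrtrV; last by rewrite subr_ge0 ltW.
  congr Num.sqrt; have E := cubic_ode_invariant T0 BT.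
  have n1 : 1 - phi 0 ^+ 2 * T != 0 by rewrite gt_eqF.
  have -> : phi T ^+ 2 = phi 0 ^+ 2 / (1 - phi 0 ^+ 2 * T) by rewrite -[X in X / _]E mulfK.
  have -> : phi 0 ^- 2 - T = (1 - phi 0 ^+ 2 * T) / phi 0 ^+ 2 by field.
  by rewrite invf_div.
rewrite -nE -sgE; case: ltrP => h; first by rewrite expr1 mulN1r ltr0_norm// opprK.
by rewrite expr0 mul1r ger0_norm.
Qed.

End CubicODE.

(** * The explicit profiles of zero curvature *)

Section ZeroCurvature.
Context {R : realType}.
Variables (b : bool) (c : R).

Definition zc_dom : set (R * R) := [set z | z.1 < c /\ 0 < z.2 ^+ 2 - z.1 + c].

Local Notation sg := ((-1) ^+ b : R).

Lemma open_zc_dom : open zc_dom.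
Proof.
have -> : zc_dom = (fst @^-1` [set t | t < c]) `&`
    ((fun z => z.2 * z.2 - z.1 + c) @^-1` [set t | 0 < t]).
  by apply/seteqP; split=> z; rewrite /zc_dom /= expr2.
apply: openI.
  by apply: open_comp; [move=> z _; exact: cvg_fst | exact: open_lt].
apply: open_comp; last exact: open_gt.
move=> z _; apply: (@smooth_in_continuous _ _ setT) => //.
apply: (smooth_inD openT) (smooth_in_cst _); apply: (smooth_inB openT) (smooth_in_r (U := _)).
by apply: (smooth_inM openT); exact: smooth_in_s.
Qed.

Lemma smooth_zc_radicand : smooth_in zc_dom (fun z : R * R => z.2 ^+ 2 - z.1 + c).
Proof.
have oz := open_zc_dom.
apply: (smooth_inD oz) (smooth_in_cst _); apply: (smooth_inB oz) (smooth_in_r (U := _)).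
by under eq_fun do rewrite expr2; apply: (smooth_inM oz); exact: smooth_in_s.
Qed.

Lemma smooth_zero_curv_p : smooth_in zc_dom (zero_curv_p b c).
Proof.
have oz := open_zc_dom.
apply: (smooth_inM oz).
  apply: (smooth_inD oz); first exact: smooth_in_s.
  apply: (smooth_inM oz) (smooth_in_cst _) _.
  by apply: smooth_in_sqrt => // [|z []//]; exact: smooth_zc_radicand.
apply: (smooth_inV oz) => [|z [zc _]]; last by rewrite subr_eq0 gt_eqF.
exact: (smooth_inB oz) (smooth_in_cst _) (smooth_in_r (U := _)).
Qed.

Lemma is_derive_zero_curv_p z v : zc_dom z -> let q := Num.sqrt (z.2 ^+ 2 - z.1 + c) in
  is_derive z v (zero_curv_p b c)
    (v.1 * (- sg / (2 * q) / (c - z.1) + (z.2 + sg * q) / (c - z.1) ^+ 2)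
     + v.2 * ((1 + sg * z.2 / q) / (c - z.1))).
Proof.
move=> [zc qpos] q; have q0 : q != 0 by rewrite gt_eqF// sqrtr_gt0.
have cz : c - z.1 != 0 by rewrite subr_eq0 gt_eqF.
have Dr := is_derive_r z v; have Ds := is_derive_s z v.
have Drad : is_derive z v (fun z : R * R => z.2 ^+ 2 - z.1 + c) (2 * z.2 * v.2 - v.1).
  under eq_fun do rewrite expr2.
  refine (is_derive_eq (is_derive_add (is_derive_sub (is_derive_mul Ds Ds) Dr)
    (is_derive_cst _ _ _)) _).
  by rewrite /=; ring.
have Dq := is_derive_comp1 (p := Num.sqrt)
  (f := fun z : R * R => z.2 ^+ 2 - z.1 + c) (is_derive1_sqrt qpos) Drad.
refine (is_derive_eq (is_derive_mul (is_derive_add Ds (is_derive_mul (is_derive_cst sg _ _) Dq))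
  (is_derive_inv (f := fun z : R * R => c - z.1) cz
    (is_derive_sub (is_derive_cst c _ _) Dr))) _).
rewrite /= -/q; move: q q0 (sg) => x x0 y; field.
by rewrite x0 cz.
Qed.

Lemma zero_curv_p_partials z : zc_dom z -> let q := Num.sqrt (z.2 ^+ 2 - z.1 + c) in
  der_r (zero_curv_p b c) z = - sg / (2 * q) / (c - z.1) + (z.2 + sg * q) / (c - z.1) ^+ 2
  /\ der_s (zero_curv_p b c) z = (1 + sg * z.2 / q) / (c - z.1).
Proof.
move=> Dz q; rewrite der_r.unlock der_s.unlock.
by split; rewrite (derive_val (is_derive := is_derive_zero_curv_p _ Dz)) /=
  mul1r mul0r ?addr0 ?add0r.
Qed.

Lemma sg_sqr : sg ^+ 2 = 1.
Proof. exact: sqrr_sign. Qed.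

(** This factorisation of the denominator rationalises the profile: it becomes
    [sg / (q - sg * s)]. *)
Let radicand z : zc_dom z -> let q := Num.sqrt (z.2 ^+ 2 - z.1 + c) in
  [/\ q != 0, c - z.1 != 0 & c - z.1 = (q - sg * z.2) * (q + sg * z.2)].
Proof.
move=> [zc qpos] q; split.
- by rewrite gt_eqF// sqrtr_gt0.
- by rewrite subr_eq0 gt_eqF.
have -> : (q - sg * z.2) * (q + sg * z.2) = q ^+ 2 - sg ^+ 2 * z.2 ^+ 2 by ring.
by rewrite sg_sqr sqr_sqrtr ?ltW//; ring.
Qed.

(** With [e] the sign and [D = q - e s], one has [p = e / D], [p_s = 1 / (q D)] and
    [p_r = e / (2 q D^2)]. Both equations follow from [e^2 = 1] and [D + e s = q]. *)
Lemma zero_curv_p_PDE z : zc_dom z ->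
  2 * der_r (zero_curv_p b c) z = zero_curv_p b c z * der_s (zero_curv_p b c) z /\
  der_s (zero_curv_p b c) z + z.2 * zero_curv_p b c z * der_s (zero_curv_p b c) z
    = zero_curv_p b c z ^+ 2.
Proof.
move=> Dz; have [-> ->] := zero_curv_p_partials Dz.
have [q0 cz cE] := radicand Dz; rewrite /zero_curv_p.
set q := Num.sqrt _ in q0 cE *; have s2 := sg_sqr.
move: q (sg) z.2 (c - z.1) q0 cz s2 cE => q e s d q0 d0 s2 dE.
have q2 : q ^+ 2 = d + s ^+ 2.
  by rewrite dE -[s ^+ 2]mul1r -s2; ring.
have n1 : q - e * s != 0 by apply: contra_neq d0 => n0; rewrite dE n0 mul0r.
have n2 : q + e * s != 0 by apply: contra_neq d0 => n0; rewrite dE n0 mulr0.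
have pE : (s + e * q) / d = e / (q - e * s).
  rewrite dE; have -> : s + e * q = e * (q + e * s).
    by rewrite mulrDr mulrA -expr2 s2 mul1r addrC.
  by field; rewrite n1 n2.
have psE : (1 + e * s / q) / d = (q * (q - e * s))^-1.
  by rewrite dE; field; rewrite q0 n1 n2.
have prE : - e / (2 * q) / d + (s + e * q) / d ^+ 2 = e / (2 * q * (q - e * s) ^+ 2).
  have -> : (s + e * q) / d ^+ 2 = (s + e * q) / d / d by field.
  rewrite pE dE.
  have -> : - e / (2 * q) / ((q - e * s) * (q + e * s)) +
     e / (q - e * s) / ((q - e * s) * (q + e * s)) =
     e * (q + e * s) / (2 * q * (q - e * s) ^+ 2 * (q + e * s)).
    by field; rewrite q0 n1 n2.
  by field; rewrite q0 n1 n2.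
rewrite prE psE pE; split; first by field; rewrite q0 n1.
have -> : (e / (q - e * s)) ^+ 2 = e ^+ 2 / (q - e * s) ^+ 2 by field.
rewrite s2; by field; rewrite q0 n1.
Qed.

Lemma zero_curv_p_profile z : zc_dom z ->
  zero_curv_p b c z - z.2 * der_s (zero_curv_p b c) z
    = - zero_curv_u b c (z.1 - z.2 ^+ 2).
Proof.
move=> Dz; have [_ ->] := zero_curv_p_partials Dz.
have [q0 cz cE] := radicand Dz; rewrite /zero_curv_p /zero_curv_u.
have -> : c - (z.1 - z.2 ^+ 2) = z.2 ^+ 2 - z.1 + c by ring.
set q := Num.sqrt _ in q0 cE *; have s2 := sg_sqr.
move: q (sg) z.2 (c - z.1) q0 cz s2 cE => q e s d q0 d0 s2 dE.
have q2 : d = q ^+ 2 - s ^+ 2.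
  by rewrite dE -[s ^+ 2]mul1r -s2; ring.
move: d0; rewrite q2 => d0; by field; rewrite q0 d0.
Qed.

Lemma smooth_zero_curv_u (D : set R) : (forall t, D t -> t < c) ->
  smooth_on D (zero_curv_u b c).
Proof.
move=> Dc; exists [set t | t < c]; split; [exact: open_lt | by move=> t /Dc |].
have oc : open [set t : R | t < c] by exact: open_lt.
apply: (smooth_inM oc) (smooth_in_cst _) _.
have sl : smooth_in [set t : R | t < c] (fun t => c - t).
  by apply: (smooth_inB oc) (smooth_in_cst _) _; apply: smooth_in_lin => // x.
apply: (smooth_inV oc).
  by apply: (smooth_in_sqrt oc sl) => t /=; rewrite subr_gt0.
by move=> t /= tc; rewrite gt_eqF// sqrtr_gt0 subr_gt0.
Qed.

End ZeroCurvature.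

(** * Classification *)

Section RotationInvariance.
Context {R : realType} {n : nat}.
Implicit Types (x y : 'rV[R]_n) (Omega : set 'rV[R]_n) (p : R * R -> R).

Lemma dotp_mulmx x y : dotp x y = (x *m y^T) 0 0.
Proof. by rewrite mxE; apply: eq_bigr => i _; rewrite mxE. Qed.

Lemma dotp_orthogonal (M : 'M[R]_n) x y : M *m M^T = 1%:M ->
  dotp (x *m M^T) (y *m M^T) = dotp x y.
Proof.
move=> /mulmx1C MM; rewrite !dotp_mulmx trmx_mul trmxK.
by rewrite -mulmxA (mulmxA M^T) MM mul1mx.
Qed.

Lemma rs_of_scale x y (l : R) : y != 0 -> 0 < l -> rs_of (x, l *: y) = rs_of (x, y).
Proof.
move=> y0 l0; rewrite /rs_of/= enormZ// dotpZr; congr pair.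
by field; rewrite enorm_neq0// gt_eqF.
Qed.

Lemma sph_flat_spray_coef Omega p : open Omega -> smooth_on (rs_dom Omega) p ->
  sph_flat_spray Omega (spray_coef p) p.
Proof.
move=> oO [U [oU DU sp]]; have oS := open_slit oO.
have scale x y l : slit Omega (x, y) -> 0 < l ->
    enorm (l *: y) * p (rs_of (x, l *: y)) = l * (enorm y * p (rs_of (x, y))).
  by move=> [_ y0] l0; rewrite enormZ// rs_of_scale//; ring.
split.
- split=> [i|i x y l sxy l0].
    exists (slit Omega); split=> //; apply: (smooth_inM oS).
      apply: (smooth_inM oS); first exact: smooth_in_enorm2.
      exact: (smooth_in_rs oO oU DU sp).
    exact: smooth_in_coord2.
  by rewrite /spray_coef/= scale// mxE; ring.
- move=> M MM i x y sxy; rewrite /spray_coef/= /rs_of/= /enorm !dotp_orthogonal//.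
  by rewrite mxE mulr_sumr; apply: eq_bigr => j _; rewrite mxE; ring.
- by exists (fun z => enorm z.2 * p (rs_of z)); split=> // x y l; exact: scale.
- by exists U.
- by [].
Qed.

End RotationInvariance.

Section Classification.
Context {R : realType}.
Variables (n : nat) (Omega : set 'rV[R]_n) (B : set R).
Hypotheses (hn : (2 <= n)%N) (rB : radial Omega B).

Lemma integral_form_exists (u v : R -> R) :
  smooth_on (r_dom Omega) u -> smooth_on (r_dom Omega) v ->
  exists p : R * R -> R, smooth_on (rs_dom Omega) p /\ integral_form Omega u v p.
Proof.
move=> [Uu [oUu DUu su]] [Uv [oUv DUv sv]]; have [oB dB B0 _] := rB.
have r0 : r_dom Omega 0 by apply/(r_domE hn rB).
have [e /= e0 He] : exists2 e : R, 0 < e & forall t : R, `|t| < e -> Uu t /\ Uv t.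
  have : nbhs (0 : R) (Uu `&` Uv).
    apply: open_nbhs_nbhs; split; first exact: openI.
    by split; [exact: DUu | exact: DUv].
  move=> /nbhs_ballP[e /= e0 He]; exists e => // t te.
  by apply: He; rewrite /ball/= sub0r normrN.
(* Around a point with [s^2 = r] the value [r - s^2] also becomes negative, so smoothness there
   needs [u] and [v] slightly to the left of [0]. *)
pose I : set R := [set t | - e < t] `&` B.
have oI : open I by apply: openI => //; exact: open_gt.
have cI (a b t : R) : I a -> I b -> a <= t <= b -> I t.
  move=> [ea _] [_ Bb] /andP[a_t tb]; split; first exact: lt_le_trans a_t.
  exact: dB Bb tb.
have IU t : I t -> Uu t /\ Uv t.
  move=> [et Bt]; have [t0|t0] := leP 0 t.
    by have rt : r_dom Omega t by [apply/(r_domE hn rB)]; split; [exact: DUu | exact: DUv].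
  by apply: He; rewrite ltr0_norm//= ltrNl.
have sIu : smooth_in I u by apply: smooth_in_sub su => t /IU[].
have sIv : smooth_in I v by apply: smooth_in_sub sv => t /IU[].
have sIu1 := smooth_in_derive (1 : R) sIu.
have oD := open_parab_dom oI.
have rsD (r s : R) : rs_dom Omega (r, s) -> parab_dom I (r, s).
  move=> /(rs_domE hn rB)[sr Br]; have s20 := sqr_ge0 s.
  have e00 : - e < 0 by rewrite oppr_lt0.
  split; split=> //=.
  - exact: lt_le_trans e00 (le_trans s20 sr).
  - by apply: lt_le_trans e00 _; rewrite subr_ge0.
  - by apply: dB Br _; rewrite gerBl.
have s2 : smooth_in (parab_dom I) (fun z : R * R => z.2 ^+ 2).
  by under eq_fun do rewrite expr2; apply: (smooth_inM oD); exact: smooth_in_s.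
(* Integration by parts gives [- u (r - s^2) / s] minus twice an antiderivative of [u' (r - s^2)],
   taken to vanish at [s = 0]. Multiplication by [s] removes the singularity. *)
pose q (z : R * R) := - u (z.1 - z.2 ^+ 2) - 2 * z.2 ^+ 2 * parab_int 0 ('D_1 u) z.
have sq : smooth_in (parab_dom I) q.
  apply: (smooth_inB oD).
    apply: (smooth_inN oD); apply: (smooth_in_comp1 oD oI sIu) => [|z [] //].
    exact: (smooth_inB oD) (smooth_in_r (U := _)) s2.
  apply: (smooth_inM oD); last exact: smooth_in_parab_int.
  exact: (smooth_inM oD) (smooth_in_cst _) s2.
pose A (r s : R) := - u (r - s ^+ 2) / s - 2 * (s * parab_int 0 ('D_1 u) (r, s)).
have qA (r s : R) : s != 0 -> q (r, s) = A r s * s.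
  by move=> s0; rewrite /q /A /=; field.
exists (fun z => q z + v z.1 * z.2); split.
  exists (parab_dom I); split=> // [[r s]|]; first exact: rsD.
  apply: (smooth_inD oD) => //; apply: (smooth_inM oD); last exact: smooth_in_s.
  by apply: (smooth_in_comp1 oD oI sIv) => [|z [] //]; exact: smooth_in_r.
exists A; split; last by move=> r s _ s0; rewrite qA// -mulrDl.
split; last by exists q; split=> [|r s _]; [exists (parab_dom I); split=> // [[r s]]; exact: rsD | exact: qA].
move=> r s rs s0; have Drs := rsD _ _ rs; have [_ Irs] := Drs.
have Du : is_derive (r - s ^+ 2) (1 : R) u ('D_1 u (r - s ^+ 2)).
  exact: is_derive_diff (smooth_in_diff sIu Irs).
have Dl : is_derive s (1 : R) (fun s : R => r - s ^+ 2) (- (2 * s)).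
  refine (is_derive_eq (is_derive_sub (is_derive_cst r _ _)
    (is_deriveX 2 (is_derive_id _ _))) _).
  by rewrite sub0r expr1 [_ *: _]mulr1.
have Dc := is_derive_comp1 (p := u) (f := fun s : R => r - s ^+ 2) Du Dl.
have Dq := is_derive_mul (is_derive_opp Dc) (is_derive_inv s0 (is_derive_id s (1 : R))).
have DF := is_derive_parab_primitive oI cI sIu1 Drs.
refine (is_derive_eq (is_derive_sub Dq (is_derive_mul (is_derive_cst (2 : R) _ _) DF)) _).
rewrite /=; move: ('D_1 u (r - s ^+ 2)) (u (r - s ^+ 2)) (parab_int _ _ _) => *.
by field.
Qed.

Variables (p : R * R -> R) (U : set (R * R)).
Hypotheses (oU : open U) (DU : rs_dom Omega `<=` U) (sp : smooth_in U p).
Variable G : 'I_n -> 'rV[R]_n * 'rV[R]_n -> R.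
Hypothesis GE : forall i z, slit Omega z -> G i z = spray_coef p i z.

Let DB (r s : R) : s ^+ 2 <= r -> B r -> U (r, s).
Proof. by move=> sr Br; apply/DU/(rs_domE hn rB). Qed.

Let pair_cst_smooth : exists W : set R, [/\ open W, r_dom Omega `<=` W &
  smooth_in W (fun t => p (t, 0))].
Proof.
pose W : set R := (fun t : R => (t, 0 : R)) @^-1` U.
have oW : open W.
  apply: open_comp => // t _.
  by apply: (@cvg_pair _ _ _ _ (nbhs t) (nbhs (0 : R))); [exact: cvg_id|exact: cvg_cst].
exists W; split=> //.
  by move=> t /(r_domE hn rB)[t0 Bt]; apply: DB => //; rewrite expr0n.
apply: (smooth_in_comp2 oW oU sp) => //; last exact: smooth_in_cst.
by apply: smooth_in_lin => // x.
Qed.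

Lemma isotropic_integral_form : isotropic_curvature Omega G <->
  (exists u v : R -> R, [/\ smooth_on (r_dom Omega) u, smooth_on (r_dom Omega) v &
     integral_form Omega u v p]).
Proof.
rewrite (isotropic_isoE hn rB oU DU sp GE); split=> [E0|[u [v [_ _ up]]]].
  have [W [oW DW sW]] := pair_cst_smooth.
  exists (fun t => - p (t, 0)), (fun=> 0); split.
  - by exists W; split=> //; exact: smooth_inN.
  - by exists setT; split=> //; [exact: openT | exact: smooth_in_cst].
  - apply: (integral_form_profile hn rB oU DU sp) => r s sr Br _.
    by rewrite (isoE_characteristic hn rB oU DU sp E0)// opprK.
apply: (isoE_profile hn rB oU DU sp (u := u)).
exact: (profile_integral_form hn rB DU sp up).
Qed.

Lemma zero_curvature_isotropic : zero_curvature Omega G -> isotropic_curvature Omega G.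
Proof.
move=> Z; exists (fun=> 0), (fun=> fun=> 0); split=> [z sz|k z sz].
  split=> [i k|]; first by rewrite Z// !mul0r subr0.
  by rewrite big1// => k _; rewrite mul0r.
by rewrite /dy derive_cst mulr0.
Qed.

Lemma zero_curvature_cases : zero_curvature Omega G ->
  (forall rs, rs_dom Omega rs -> p rs = 0) \/
  exists (c : R) (b : bool), [/\ 0 < c, Omega `<=` eball n (Num.sqrt c) &
    forall rs, rs_dom Omega rs -> p rs = zero_curv_p b c rs].
Proof.
move=> Z; have [oB dB B0 OB] := rB.
have H := (zero_PDE hn rB oU DU sp GE).1 Z.
have E0 := (isotropic_isoE hn rB oU DU sp GE).1 (zero_curvature_isotropic Z).
have W := isoE_characteristic hn rB oU DU sp E0.
pose phi t := p (t, 0).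
(* With [w = p - s p_s], expanding [w (1 + s p)] and inserting the second equation leaves [p]. *)
have key (r s : R) : s ^+ 2 <= r -> B r ->
    p (r, s) * (1 - s * phi (r - s ^+ 2)) = phi (r - s ^+ 2).
  move=> sr Br; have [_ H2] := H r s sr Br; rewrite /phi -W//.
  transitivity (p (r, s) - s * (p (r, s) ^+ 2 - s * p (r, s) * der_s p (r, s))); first by ring.
  by rewrite -H2; ring.
have ode (t : R) : 0 <= t -> B t -> is_derive t (1 : R) phi (phi t ^+ 3 / 2).
  move=> t0 Bt; have t02 : (0 : R) ^+ 2 <= t by rewrite expr0n.
  have [H1 H2] := H t 0 t02 Bt.
  refine (is_derive_eq (is_derive_partials (p := p) (smooth_in_diff sp (DB t02 Bt))
    (is_derive_id _ _) (is_derive_cst (0 : R) _ _)) _).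
  move: H2; rewrite !mul0r !addr0 mul1r => H2.
  apply: (@mulfI _ 2); rewrite ?pnatr_eq0// H1 H2 /phi.
  by field.
have tB (r s : R) : s ^+ 2 <= r -> B r -> 0 <= r - s ^+ 2 /\ B (r - s ^+ 2).
  by move=> sr Br; split; [rewrite subr_ge0 | apply: dB Br _; rewrite gerBl sqr_ge0].
have [p0|p0] := eqVneq (phi 0) 0.
  left=> -[r s] /(rs_domE hn rB)[sr Br]; have [t0 Bt] := tB r s sr Br.
  by have := key r s sr Br; rewrite (cubic_ode_zero dB ode p0 t0 Bt) mulr0 subr0 mulr1.
(* The number [c] is the time at which the solution [phi] would blow up, so [B] cannot reach it and
   [Omega] lies in the ball of radius [sqrt c]. The sign of [phi 0] is kept for all times and
   selects [b]. *)
right; pose c := phi 0 ^- 2; pose b := phi 0 < 0; exists c, b.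
have c0 : 0 < c by rewrite invr_gt0 lt_def sqr_ge0 sqrf_eq0 p0.
have nz (t : R) t0 Bt := @cubic_ode_nonzero _ B phi dB ode t p0 t0 Bt.
split=> // [x /OB Bx|[r s] /(rs_domE hn rB)[sr Br]].
  have [xc _] := nz _ (sqr_ge0 _) Bx.
  rewrite /eball/= -[ltLHS]ger0_norm ?sqrtr_ge0// -sqrtr_sqr.
  by rewrite ltr_sqrt.
have [t0 Bt] := tB r s sr Br.
have r0 : 0 <= r by apply: le_trans sr; exact: sqr_ge0.
have [rc _] := nz r r0 Br; have [tc pE] := nz _ t0 Bt.
have := key r s sr Br; rewrite pE /zero_curv_p/= -/c -/b.
have -> : c - (r - s ^+ 2) = s ^+ 2 - r + c by ring.
have q0 : 0 < Num.sqrt (s ^+ 2 - r + c) by rewrite sqrtr_gt0; move: tc; rewrite -/c; lra.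
have q2 : Num.sqrt (s ^+ 2 - r + c) ^+ 2 = s ^+ 2 - r + c.
  by rewrite sqr_sqrtr//; move: tc; rewrite -/c; lra.
have cr : c - r != 0 by rewrite subr_eq0 gt_eqF.
have e2 : ((-1) ^+ b : R) ^+ 2 = 1 by exact: sqrr_sign.
move: (Num.sqrt _) ((-1) ^+ b : R) q0 q2 e2 => q e q0 q2 e2 E.
have qn0 : q != 0 by rewrite gt_eqF.
have cE : c - r = q ^+ 2 - e ^+ 2 * s ^+ 2 by rewrite q2 e2; ring.
(* Here [w = e / q]. Multiplying by [q + e s] then produces [c - r] on the left, by its
   factorisation, and the stated numerator on the right. *)
have E' : p (r, s) * (q - e * s) = e.
  have -> : q - e * s = (1 - s * (e / q)) * q by field.
  by rewrite [LHS]mulrA E divfK.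
apply: (mulIf cr); rewrite divfK// cE.
have -> : p (r, s) * (q ^+ 2 - e ^+ 2 * s ^+ 2) = p (r, s) * (q - e * s) * (q + e * s) by ring.
by rewrite E' mulrDr mulrA -expr2 e2 mul1r addrC.
Qed.

(** Equality on [rs_dom Omega] does not by itself compare derivatives at its boundary points, where
    both are derivatives of extensions. They agree on the open part [O], hence everywhere by
    continuity. *)
Lemma profile_der_eq (W : set (R * R)) (q : R * R -> R) : open W ->
  rs_dom Omega `<=` W -> smooth_in W q ->
  (forall rs, rs_dom Omega rs -> p rs = q rs) ->
  forall r s : R, s ^+ 2 <= r -> B r ->
  der_r p (r, s) = der_r q (r, s) /\ der_s p (r, s) = der_s q (r, s).
Proof.
move=> oW DW sq pq r s sr Br; have [oB _ _ _] := rB.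
have DBW (r' s' : R) : s' ^+ 2 <= r' -> B r' -> W (r', s').
  by move=> sr' Br'; apply/DW/(rs_domE hn rB).
pose O : set (R * R) := [set z | 0 < z.1 - z.2 * z.2] `&` (fst @^-1` B).
have oO : open O.
  apply: openI; last by apply: open_comp => // z _; exact: cvg_fst.
  apply: (@open_comp _ _ (fun z : R * R => z.1 - z.2 * z.2) [set t | 0 < t]); last exact: open_gt.
  move=> z _; apply: (@smooth_in_continuous _ _ setT) => //.
  apply: (smooth_inB openT) (smooth_in_r (U := _)) _.
  by apply: (smooth_inM openT); exact: smooth_in_s.
have pqO z : O z -> p z = q z.
  case: z => x y [/= xy Bx]; apply: pq; apply/(rs_domE hn rB); split=> //.
  by rewrite expr2 -subr_ge0 ltW.
have inO (r' s' : R) : s' ^+ 2 < r' -> B r' -> O (r', s').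
  by move=> sr' Br'; split=> //=; rewrite subr_gt0 -expr2.
have cont (f g : R * R -> R) : smooth_in U f -> smooth_in W g ->
    forall r s : R, s ^+ 2 <= r -> B r -> {for (r, s), continuous (fun z => f z - g z)}.
  move=> sf sg r' s' sr' Br'; apply: cvgB.
    exact: smooth_in_continuous sf (DB sr' Br').
  exact: smooth_in_continuous sg (DBW _ _ sr' Br').
split; apply/eqP; rewrite -subr_eq0; apply/eqP.
- apply: (@rs_dom_dense _ _ _ _ rB (fun z => der_r p z - der_r q z)) => //.
    exact: cont (smooth_in_der_r sp) (smooth_in_der_r sq).
  by move=> r' s' _ sr' Br'; rewrite (der_r_eq oO pqO (inO _ _ sr' Br')) subrr.
- apply: (@rs_dom_dense _ _ _ _ rB (fun z => der_s p z - der_s q z)) => //.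
    exact: cont (smooth_in_der_s sp) (smooth_in_der_s sq).
  by move=> r' s' _ sr' Br'; rewrite (der_s_eq oO pqO (inO _ _ sr' Br')) subrr.
Qed.

Lemma zero_curvature_zero : (forall rs, rs_dom Omega rs -> p rs = 0) ->
  zero_curvature Omega G.
Proof.
move=> p0; apply/(zero_PDE hn rB oU DU sp GE) => r s sr Br.
have [-> ->] := profile_der_eq openT (@subsetT _ _) (smooth_in_cst 0) p0 sr Br.
have d0 : der_r (fun=> 0 : R) (r, s) = 0 /\ der_s (fun=> 0 : R) (r, s) = 0.
  by rewrite der_r.unlock der_s.unlock !derive_cst.
rewrite d0.1 d0.2 p0; last exact/(rs_domE hn rB).
by rewrite !mulr0 addr0 expr0n.
Qed.

Lemma rs_dom_zc_dom (c : R) : (forall r, 0 <= r -> B r -> r < c) ->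
  rs_dom Omega `<=` zc_dom c.
Proof.
move=> Bc [r s] /(rs_domE hn rB)[sr Br].
have r0 : 0 <= r by apply: le_trans sr; exact: sqr_ge0.
have rc := Bc r r0 Br; split=> //=; have := sqr_ge0 s; lra.
Qed.

Lemma zero_curvature_zero_curv_p (c : R) (b : bool) : 0 < c ->
  Omega `<=` eball n (Num.sqrt c) ->
  (forall rs, rs_dom Omega rs -> p rs = zero_curv_p b c rs) ->
  zero_curvature Omega G.
Proof.
move=> c0 Oc pE; apply/(zero_PDE hn rB oU DU sp GE) => r s sr Br.
have Bc (t : R) : 0 <= t -> B t -> t < c.
  move=> t0 Bt; have [x /Oc xc <-] : r_dom Omega t by apply/(r_domE hn rB).
  by rewrite -(sqr_sqrtr (ltW c0)) ltr_pXn2r ?nnegrE ?sqrtr_ge0.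
have Dz := rs_dom_zc_dom Bc.
have [-> ->] := profile_der_eq (@open_zc_dom _ c) Dz (@smooth_zero_curv_p _ b c) pE sr Br.
have drs : rs_dom Omega (r, s) by apply/(rs_domE hn rB).
rewrite pE//; exact: zero_curv_p_PDE (Dz _ drs).
Qed.

End Classification.

Theorem theorem1p2 (R : realType) (n : nat) (hn : (2 <= n)%N)
    (Omega : set 'rV[R]_n)
    (hOmega : Omega = setT \/ exists rho : R, 0 < rho /\ Omega = eball n rho)
    (G : 'I_n -> 'rV[R]_n * 'rV[R]_n -> R) (p : R * R -> R)
    (hG : sph_flat_spray Omega G p) :
  [/\ isotropic_curvature Omega G <->
        (exists u v : R -> R,
          [/\ smooth_on (r_dom Omega) u, smooth_on (r_dom Omega) v &
              integral_form Omega u v p]),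
      (forall u v : R -> R,
        smooth_on (r_dom Omega) u -> smooth_on (r_dom Omega) v ->
        exists p' : R * R -> R,
          smooth_on (rs_dom Omega) p' /\ integral_form Omega u v p'),
      zero_curvature Omega G <->
        ((forall rs, rs_dom Omega rs -> p rs = 0) \/
         (exists (c : R) (b : bool),
           [/\ 0 < c, Omega `<=` eball n (Num.sqrt c) &
               forall rs, rs_dom Omega rs -> p rs = zero_curv_p b c rs])),
      sph_flat_spray [set: 'rV[R]_n] (spray_coef (fun=> 0)) (fun=> 0) &
      forall (c : R) (b : bool), 0 < c ->
        sph_flat_spray (eball n (Num.sqrt c))
          (spray_coef (zero_curv_p b c)) (zero_curv_p b c) /\
        (exists v : R -> R,
          [/\ smooth_on (r_dom (eball n (Num.sqrt c))) (zero_curv_u b c),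
              smooth_on (r_dom (eball n (Num.sqrt c))) v &
              integral_form (eball n (Num.sqrt c))
                (zero_curv_u b c) v (zero_curv_p b c)])].
Proof.
have [B rB] := radial_exists hOmega; have [_ _ _ [U [oU DU sp]] GE] := hG.
split.
- exact: (isotropic_integral_form hn rB oU DU sp GE).
- by move=> u v; exact: (integral_form_exists hn rB).
- split; first exact: (zero_curvature_cases hn rB oU DU sp GE).
  case=> [|[c [b [c0 Oc pE]]]]; first exact: (zero_curvature_zero hn rB oU DU sp GE).
  exact: (zero_curvature_zero_curv_p hn rB oU DU sp GE c0 Oc pE).
- apply: sph_flat_spray_coef; first exact: openT.
  by exists setT; split=> //; [exact: openT | exact: smooth_in_cst].
move=> c b c0; have rc0 : 0 < Num.sqrt c by rewrite sqrtr_gt0.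
have rC := @radial_eball R n _ rc0.
have Bc (r : R) : 0 <= r -> r < Num.sqrt c ^+ 2 -> r < c.
  by move=> _; rewrite sqr_sqrtr ?(ltW c0).
have Dz := rs_dom_zc_dom hn rC Bc.
split.
  apply: sph_flat_spray_coef; first exact: radial_open rC.
  by exists (zc_dom c); split=> //; [exact: open_zc_dom | exact: smooth_zero_curv_p].
(* The appropriate [v] is zero once the antiderivative is taken to be [p / s]. *)
exists (fun=> 0); split.
- by apply: smooth_zero_curv_u => t /(r_domE hn rC)[t0]; exact: Bc.
- by exists setT; split=> //; [exact: openT | exact: smooth_in_cst].
apply: (integral_form_profile hn rC (@open_zc_dom _ c) Dz (@smooth_zero_curv_p _ b c)).
move=> r s sr Br _; apply: zero_curv_p_profile.
by apply: Dz; apply/(rs_domE hn rC).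
Qed.
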